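(* Let $K$ be a simplicial $3$-sphere with at most $20$ vertices. Then $K$ has the toric lifting property; that is, every mod $2$ characteristic map $\lambda^{\mathbb R}\colon V(K)\to\mathbb Z_2^4$ over $K$ admits a lift $\lambda\colon V(K)\to\mathbb Z^4$.
   Context: $\mathbb Z_2=\mathbb Z/2\mathbb Z$. A simplicial $3$-sphere is a (finite, abstract) simplicial complex whose geometric realization is homeomorphic to the sphere $S^3$. $V(K)$ is the vertex set of $K$; facets are maximal simplices. A mod $2$ characteristic map over a simplicial $3$-sphere $K$ is a map $\lambda^{\mathbb R}\colon V(K)\to\mathbb Z_2^4$ such that the images of the four vertices of every facet of $K$ form a basis of $\mathbb Z_2^4$. An integral characteristic map over $K$ is a map $\lambda\colon V(K)\to\mathbb Z^4$ such that the images of the four vertices of every facet form a basis of $\mathbb Z^4$. A lift of $\lambda^{\mathbb R}$ is an integral characteristic map $\lambda$ over $K$ with $\lambda(v)\equiv\lambda^{\mathbb R}(v)\pmod 2$ for every vertex $v$. $K$ has the toric lifting property if every mod $2$ characteristic map over $K$ admits a lift. *)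

(* Defs.v *)
From HB Require Import structures.
From mathcomp Require Import all_boot all_order all_algebra.
From mathcomp Require Import all_classical all_reals all_analysis.

Set Implicit Arguments.
Unset Strict Implicit.
Unset Printing Implicit Defensive.

Import Order.TTheory GRing.Theory Num.Theory.
Import numFieldNormedType.Exports.

Local Open Scope classical_set_scope.
Local Open Scope ring_scope.

(* A complex on a finite ground set T is the family of its simplices, the empty
   one included. Elements of T need not be vertices: V(K) is [vertices K]. *)
Definition simplicial_complex (T : finType) (K : {set {set T}}) : Prop :=
  finset.set0 \in K /\
  forall s t : {set T}, s \in K -> t \subset s -> t \in K.

Definition vertices (T : finType) (K : {set {set T}}) : {set T} :=
  [set v | [set v]%SET \in K]%SET.

Definition facet (T : finType) (K : {set {set T}}) (s : {set T}) : Prop :=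
  finset.maxset [pred t in K] s.

(* Barycentric coordinates. [{ptws T -> R}] is R^T with the product topology,
   which for finite T is the Euclidean one. *)
Definition geometric_realization (R : realType) (T : finType)
    (K : {set {set T}}) : set {ptws T -> R} :=
  [set x : {ptws T -> R} |
    [/\ forall v : T, 0 <= x v,
        \sum_(v : T) x v = 1 &
        [set v | x v != 0]%SET \in K]].

(* Written with coordinates because the norm of ['rV[R]_4] is the sup norm. *)
Definition sphere3 (R : realType) : set 'rV[R]_4 :=
  [set x : 'rV[R]_4 | \sum_(i < 4) x 0 i ^+ 2 = 1].

(* A and B carry the subspace topologies; the values of f outside A and of g
   outside B are irrelevant. *)
Definition homeomorphic (X Y : topologicalType) (A : set X) (B : set Y) : Prop :=
  exists (f : X -> Y) (g : Y -> X),
    [/\ (forall x, A x -> B (f x) /\ g (f x) = x),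
        (forall y, B y -> A (g y) /\ f (g y) = y),
        {within A, continuous f} &
        {within B, continuous g}].

Definition simplicial_3sphere (R : realType) (T : finType)
    (K : {set {set T}}) : Prop :=
  simplicial_complex K /\
  homeomorphic (@geometric_realization R T K) (@sphere3 R).

(* The family (u i), for i in A, is a basis of the R-module V (vector.v only
   has bases over fields, and both 'F_2 and int are needed). *)
Definition family_basis (R : pzRingType) (V : lmodType R) (I : finType)
    (A : {set I}) (u : I -> V) : Prop :=
  (forall c : I -> R,
     \sum_(i in A) c i *: u i = 0 -> forall i, i \in A -> c i = 0) /\
  (forall x : V, exists c : I -> R, x = \sum_(i in A) c i *: u i).

(* Maps on V(K) are represented by maps on T; only the values on V(K) are
   constrained, as every facet is a set of vertices. *)
Definition characteristic_map (R : pzRingType) (T : finType)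
    (K : {set {set T}}) (lam : T -> 'rV[R]_4) : Prop :=
  forall s : {set T}, facet K s -> family_basis s lam.

Definition mod2_characteristic_map (T : finType) (K : {set {set T}})
    (lamR : T -> 'rV['F_2]_4) : Prop :=
  characteristic_map K lamR.

Definition integral_characteristic_map (T : finType) (K : {set {set T}})
    (lam : T -> 'rV[int]_4) : Prop :=
  characteristic_map K lam.

Definition is_lift (T : finType) (K : {set {set T}})
    (lamR : T -> 'rV['F_2]_4) (lam : T -> 'rV[int]_4) : Prop :=
  integral_characteristic_map K lam /\
  forall v, v \in vertices K -> map_mx (intr : int -> 'F_2) (lam v) = lamR v.

Definition toric_lifting_property (T : finType) (K : {set {set T}}) : Prop :=
  forall lamR : T -> 'rV['F_2]_4, mod2_characteristic_map K lamR ->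
    exists lam : T -> 'rV[int]_4, is_lift K lamR lam.

(* Main.v *)
Require Import Defs.
From mathcomp Require Import all_boot all_order all_algebra.
From mathcomp Require Import all_classical all_reals all_analysis.
From mathcomp Require Import fingroup perm ring lra zify.
From mathcomp Require Import seq fintype finset.

(** Two facts make the theorem true: few tetrahedra, and a large group to
    choose from.

    A vector of F_2^4 has an obvious integral lift with entries 0 and 1. Four
    vectors forming a basis of F_2^4 lift to a matrix of odd determinant, and a
    0/1 matrix of size 4 has determinant at most 3 in absolute value, so the
    lift is a basis of Z^4 unless the determinant is 3 or -3. Exactly 120
    matrices are bad in this sense ([card_bad_lift] proves the upper bound),
    while GL_4(F_2) has 20160 = 168 * 120 elements ([card_GL4]). Before
    lifting, the vectors may be moved by any g in GL_4(F_2), since g^-1 lifts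
    to a unimodular integral matrix ([unimodular_lift]), which undoes the move
    after the lift. For a given tetrahedron, at most 120 of the g are bad; so a
    g that is good for all tetrahedra exists as soon as there are fewer than
    168 tetrahedra.

    Let f_i be the number of faces of dimension i. In a triangulated 3-sphere
    every triangle lies in two tetrahedra and the Euler characteristic is 0,
    whence f_3 = f_1 - f_0 ([tetrahedra_edges]). Adjacent vertices have
    distinct vectors, so the edge graph is coloured by the 16 vectors of F_2^4
    and Turan's bound gives 32 f_1 <= 15 f_0^2 ([turan_edges]). With at most 20
    vertices this leaves at most 167 tetrahedra ([few_tetrahedra]): one less
    than 168.

    The topological input, for a complex known only through a homeomorphism of
    its realization with the sphere, is a single statement: for every nonempty
    simplex tau, the faces not containing tau have alternating sum 0
    ([sphere_deletion_euler]). Comparing this sum with that over K, for tau a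
    tetrahedron and then a triangle, yields both the Euler characteristic and
    the number of tetrahedra at a triangle. To prove it, note that the subcomplex
    of the faces not containing tau is a retract of |K| minus the barycenter of
    tau, that is, of a punctured sphere; so its realization is contractible
    ([deletion_contractible]). A complex with contractible realization has an
    exact augmented chain complex over F_2 ([contractible_exact]), and then the
    numbers of even and odd faces agree ([exact_even_odd]).

    For exactness, chains are lists of tuples of points of the realization, known
    through their values on functionals. A simplicial cycle is replaced by a chain of tuples of
    small diameter ([subdivision]), pushed along the contraction in finitely many
    steps, the prisms swept out being still small ([chain_contraction]), and
    brought back to the complex by sending a point to a vertex at which it has a
    large barycentric coordinate. *)

Set Implicit Arguments.
Unset Strict Implicit.
Unset Printing Implicit Defensive.

Import Order.TTheory GRing.Theory Num.Theory.
Import numFieldNormedType.Exports.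

Local Open Scope ring_scope.

(** * Mod 2 chains of tuples *)

Lemma addF2 (a : 'F_2) : a + a = 0.
Proof. by case: a => [[|[|]]] // i; apply/val_inj. Qed.

(** Chains are never compared as lists: a chain is known through its values on
    functionals [f], and the boundary acts on functionals by its transpose,
    which is this sum of the values at the tuples with one entry deleted. The
    empty tuple is allowed, so that the complex is augmented. *)
Fixpoint tuple_cobd (X : Type) (f : seq X -> 'F_2) (t : seq X) : 'F_2 :=
  if t is x :: t' then f t' + tuple_cobd (fun u => f (x :: u)) t' else 0.

Lemma tuple_cobd_map (X Y : Type) (h : X -> Y) (f : seq Y -> 'F_2) t :
  tuple_cobd f (map h t) = tuple_cobd (fun u => f (map h u)) t.
Proof. by elim: t f => //= x t IH f; rewrite IH. Qed.

Section Chains.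
Variable X : eqType.
Implicit Types (f : seq X -> 'F_2) (t : seq X) (c w : seq (seq X)).

Lemma eq_tuple_cobd f f' t : f =1 f' -> tuple_cobd f t = tuple_cobd f' t.
Proof.
elim: t f f' => //= x t IH f f' e; rewrite e; congr (_ + _).
by apply: IH => u; rewrite e.
Qed.

Lemma tuple_cobdD f f' t :
  tuple_cobd (fun u => f u + f' u) t = tuple_cobd f t + tuple_cobd f' t.
Proof.
elim: t f f' => [|x t IH] f f' /=; first by rewrite addr0.
by rewrite IH addrACA.
Qed.

Lemma tuple_cobd_cobd f t : tuple_cobd (tuple_cobd f) t = 0.
Proof.
elim: t f => //= x t IH f; rewrite tuple_cobdD IH addr0; exact: addF2.
Qed.

Fixpoint prism (h h' : X -> X) t : seq (seq X) :=
  if t is x :: t' then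
    (h x :: h' x :: map h' t') :: map (cons (h x)) (prism h h' t')
  else [::].

(** The prism between the images of a tuple under [h] and [h'] is bounded by
    these images and by the prism over the boundary of the tuple. *)
Lemma prism_boundary h h' f t :
  \sum_(u <- prism h h' t) tuple_cobd f u +
    tuple_cobd (fun u => \sum_(s <- prism h h' u) f s) t
  = f (map h t) + f (map h' t).
Proof.
elim: t f => [|x t IH] f /=; first by rewrite big_nil addr0 addF2.
rewrite big_cons /= tuple_cobd_map big_map /= big_split /=.
have -> : tuple_cobd (fun u => \sum_(s <- prism h h' (x :: u)) f s) t =
    tuple_cobd (fun u => f (h x :: h' x :: map h' u)) t +
    tuple_cobd (fun u => \sum_(s <- prism h h' u) f (h x :: s)) t.
  by rewrite -tuple_cobdD; apply: eq_tuple_cobd => u; rewrite big_cons big_map.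
move: (IH (fun u => f (h x :: u))) => /=.
set a := tuple_cobd (fun u => f (h x :: h' x :: _)) t.
set b := \sum_(u <- _) f u; set d := \sum_(u <- _) _; set e := tuple_cobd _ t.
set p := f (h' x :: _); set q := f _; set r := f _ => {}IH.
transitivity (p + (d + e) + r + (a + a) + (b + b)); first by ring.
rewrite IH !addF2; transitivity (q + p + (r + r)); first by ring.
by rewrite addF2 addr0.
Qed.

Lemma prism_size h h' t u : u \in prism h h' t -> size u = (size t).+1.
Proof.
elim: t u => //= x t IH u; rewrite inE => /orP[/eqP->|/mapP[s /IH e ->]] /=.
  by rewrite size_map.
by rewrite e.
Qed.

Lemma prism_mem h h' t u y : u \in prism h h' t -> y \in u ->
  exists2 x, x \in t & y = h x \/ y = h' x.
Proof.
elim: t u => //= x t IH u; rewrite inE => /orP[/eqP->|/mapP[s sP ->]].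
  rewrite !inE => /or3P[/eqP->|/eqP->|/mapP[z zt ->]].
  - by exists x; rewrite ?mem_head //; left.
  - by exists x; rewrite ?mem_head //; right.
  - by exists z; rewrite ?inE ?zt ?orbT //; right.
rewrite inE => /orP[/eqP->|ys]; first by exists x; rewrite ?mem_head //; left.
by have [z zt e] := IH _ sP ys; exists z; rewrite // inE zt orbT.
Qed.

Definition cycle_chain c := forall f, \sum_(t <- c) tuple_cobd f t = 0.

Definition bounds w c :=
  forall f, \sum_(u <- w) tuple_cobd f u = \sum_(t <- c) f t.

(** A contraction in discrete time steps: the cycle is the boundary of the
    prisms swept out between successive steps, together with the cone from [b]
    over the final chain, whose tuples are constant. The second part of the
    conclusion records where the filling lives: each of its tuples is either
    constant or made of points moved by one of two successive steps from one
    tuple of the cycle. *)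
Lemma chain_contraction c (m : nat) (h : nat -> X -> X) (b : X) :
    cycle_chain c ->
    (forall t x, t \in c -> x \in t -> h 0 x = x) ->
    (forall t x, t \in c -> x \in t -> h m x = b) ->
  exists2 w, bounds w c & forall u, u \in w -> exists2 t, t \in c &
    size u = (size t).+1 /\
    ((forall y, y \in u -> y = b) \/
     exists2 j, (j < m)%N & forall y, y \in u ->
       exists2 x, x \in t & y = h j x \/ y = h j.+1 x).
Proof.
move=> cc h0 hm.
pose w1 := [seq u | j <- iota 0 m,
                    u <- flatten [seq prism (h j) (h j.+1) t | t <- c]].
pose w2 := [seq b :: map (h m) t | t <- c].
exists (w1 ++ w2) => [f|u]; last first.
  rewrite mem_cat => /orP[/allpairsPdep[j [v [jm /flatten_mapP[t tc vt] ->]]]|].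
    exists t => //; split; first exact: prism_size vt.
    right; exists j; first by rewrite mem_iota in jm.
    by move=> y yv; apply: prism_mem vt yv.
  move=> /mapP[t tc ->]; exists t => //; rewrite /= size_map; split => //.
  left=> y; rewrite inE => /orP[/eqP//|/mapP[x xt ->]]; exact: hm xt.
have step j : \sum_(t <- c) \sum_(u <- prism (h j) (h j.+1) t) tuple_cobd f u =
    \sum_(t <- c) f (map (h j) t) + \sum_(t <- c) f (map (h j.+1) t).
  rewrite -big_split /= -[LHS]addr0.
  (* the prisms over the boundary of the cycle cancel *)
  rewrite -[X in _ + X = _](cc (fun u => \sum_(s <- prism (h j) (h j.+1) u) f s)).
  rewrite -big_split /=.
  by apply: eq_bigr => t _; rewrite prism_boundary.
rewrite big_cat /=.
have -> : \sum_(u <- w1) tuple_cobd f u =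
    \sum_(t <- c) f (map (h 0) t) + \sum_(t <- c) f (map (h m) t).
  rewrite big_allpairs_dep /=.
  under eq_bigr => j _ do rewrite big_flatten big_map step.
  rewrite -[m in iota 0 m]subn0 -/(index_iota 0 m).
  elim: (m) => [|k IH]; first by rewrite big_nil addF2.
  rewrite big_nat_recr //= IH.
  set x := \sum_(_ <- _) _; set y := \sum_(_ <- _) _; set z := \sum_(_ <- _) _.
  transitivity (x + z + (y + y)); first by ring.
  by rewrite addF2 addr0.
have -> : \sum_(u <- w2) tuple_cobd f u = \sum_(t <- c) f (map (h m) t).
  rewrite big_map /= big_split /=.
  under [X in _ + X]eq_bigr => t _ do rewrite tuple_cobd_map.
  by rewrite cc addr0.
rewrite -addrA addF2 addr0; apply: eq_big_seq => t tc.
congr (f _); rewrite -[RHS]map_id; apply/eq_in_map => x xt; exact: h0 xt.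
Qed.

End Chains.

(** * From tuples of vertices to simplices *)

Section SimplexChains.
Variable T : finType.
Implicit Types (f : {set T} -> 'F_2) (l : seq T).

Definition simplex_cobd f (s : {set T}) : 'F_2 := \sum_(v in s) f (s :\ v).

Definition tuple_value f l : 'F_2 := if uniq l then f [set v in l] else 0.

Lemma tuple_cobd_uniq (F : seq T -> 'F_2) l :
  uniq l -> tuple_cobd F l = \sum_(v <- l) F (rem v l).
Proof.
elim: l F => [|x l IH] F /=; first by rewrite big_nil.
move=> /andP[xl ul]; rewrite big_cons eqxx IH //; congr (_ + _).
apply: eq_big_seq => y yl; case: eqP => // e; by rewrite e yl in xl.
Qed.

(** Deleting either copy of a repeated entry gives the same tuple up to order,
    so the two contributions cancel mod 2; the others still have a repetition. *)
Lemma tuple_cobd_nonuniq (F : seq T -> 'F_2) l :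
  (forall l1 l2, perm_eq l1 l2 -> F l1 = F l2) ->
  (forall l, ~~ uniq l -> F l = 0) -> ~~ uniq l -> tuple_cobd F l = 0.
Proof.
elim: l F => [|x l IH] F //= Fp F0.
case ul: (uniq l); rewrite ?andbT ?andbF ?negbK.
  move=> xl; rewrite tuple_cobd_uniq // (bigD1_seq x) //= [X in _ + (_ + X)]big1.
    rewrite addr0 (Fp _ l) ?addF2 // perm_sym; exact: perm_to_rem.
  move=> y yx; apply: F0 => /=; rewrite negb_and negbK.
  by rewrite (rem_filter _ ul) mem_filter /= eq_sym yx xl.
move=> _; rewrite F0 ?ul // add0r; apply: IH; last by rewrite ul.
  by move=> l1 l2 p; apply: Fp; rewrite perm_cons.
by move=> k kn; apply: F0; rewrite /= negb_and kn orbT.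
Qed.

(** Forgetting order and degenerate tuples is a chain map. *)
Lemma tuple_cobd_value f l :
  tuple_cobd (tuple_value f) l = tuple_value (simplex_cobd f) l.
Proof.
rewrite {2}/tuple_value; case ul: (uniq l); last first.
  apply: tuple_cobd_nonuniq; last by rewrite ul.
    move=> l1 l2 p; rewrite /tuple_value (perm_uniq p); case: ifP => // _.
    by congr (f _); apply/setP => v; rewrite !inE (perm_mem p).
  by move=> k /negbTE; rewrite /tuple_value => ->.
rewrite tuple_cobd_uniq // /simplex_cobd big_uniq //=.
apply: eq_big => v; first by rewrite inE.
move=> vl; rewrite /tuple_value rem_uniq //; congr (f _); apply/setP => u.
by rewrite !inE rem_filter // mem_filter.
Qed.

Lemma simplex_cobd_cobd f (s : {set T}) : simplex_cobd (simplex_cobd f) s = 0.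
Proof.
have <- : [set v in enum s] = s by apply/setP => v; rewrite inE mem_enum.
have : tuple_value (simplex_cobd (simplex_cobd f)) (enum s) = 0; last first.
  by rewrite /tuple_value enum_uniq.
rewrite -!tuple_cobd_value -(eq_tuple_cobd _ (tuple_cobd_value f)).
exact: tuple_cobd_cobd.
Qed.

End SimplexChains.

(** * Exact complexes are balanced *)

Section Balance.
Variables (T : finType) (L : {set {set T}}).
Implicit Types (s : {set T}) (E O : {set {set T}}).

Definition simplex_cycle (z : {set T} -> 'F_2) :=
  forall f, \sum_(s in L) z s * simplex_cobd f s = 0.

(** Dimensions are not separated: a chain is any combination of faces, the
    empty face included. *)
Definition exact_complex := forall z, simplex_cycle z ->
  exists w : {set T} -> 'F_2, forall f,
      \sum_(s in L) w s * simplex_cobd f s = \sum_(s in L) z s * f s.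

Definition incidence E O : 'M['F_2]_(#|E|, #|O|) :=
  \matrix_(i, j) simplex_cobd (fun s' => (s' == enum_val j)%:R) (enum_val i).

Lemma simplex_cobd_incidence E O f i :
  (forall s v, s \in E -> v \in s -> s :\ v \in O) ->
  simplex_cobd f (enum_val i) = \sum_j incidence E O i j * f (enum_val j).
Proof.
move=> EO; under [RHS]eq_bigr => j _ do rewrite mxE /simplex_cobd mulr_suml.
rewrite exchange_big /=; apply: eq_bigr => v vi.
have vO := EO _ _ (enum_valP i) vi.
rewrite -(big_enum_val (fun s => (enum_val i :\ v == s)%:R * f s)).
rewrite (bigD1 (enum_val i :\ v)) //= eqxx mul1r big1 ?addr0 // => s /andP[_].
by rewrite eq_sym => /negbTE->; rewrite mul0r.
Qed.

Lemma incidence_exact E O : exact_complex -> E \subset L -> O \subset L ->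
  (forall s v, s \in E -> v \in s -> s :\ v \in O) ->
  (forall s v, s \in O -> v \in s -> s :\ v \in E) ->
  (forall s v, s \in L -> v \in s -> s :\ v \in E -> s \in O) ->
  (kermx (incidence E O) == incidence O E)%MS.
Proof.
move=> ex /subsetP EL /subsetP OL EO OE LO; apply/andP; split; last first.
  apply/sub_kermxP/matrixP => j l; rewrite mxE [RHS]mxE.
  rewrite -[RHS](simplex_cobd_cobd (fun s' => (s' == enum_val l)%:R) (enum_val j)).
  rewrite (simplex_cobd_incidence _ j OE); apply: eq_bigr => i _; congr (_ * _).
  by rewrite mxE.
apply/row_subP => k; set u := row k _.
have uA : u *m incidence E O = 0 by apply/sub_kermxP; exact: row_sub.
pose z s : 'F_2 := \sum_i u 0 i * (enum_val i == s)%:R.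
have zE g : \sum_(s in L) z s * g s = \sum_i u 0 i * g (enum_val i).
  under eq_bigr => s _ do rewrite mulr_suml.
  rewrite exchange_big /=; apply: eq_bigr => i _.
  rewrite (bigD1 (enum_val i)) ?EL ?enum_valP //= eqxx mulr1 big1 ?addr0 //.
  by move=> s /andP[_]; rewrite eq_sym => /negbTE->; rewrite mulr0 mul0r.
have [f|w wP] := ex z.
  rewrite zE.
  under eq_bigr => i _ do rewrite (simplex_cobd_incidence _ i EO) mulr_sumr.
  rewrite exchange_big big1 //= => j _.
  have /matrixP/(_ 0 j) := uA; rewrite [RHS]mxE mxE => h.
  under eq_bigr => i _ do rewrite mulrA.
  by rewrite -mulr_suml h mul0r.
apply/submxP; exists (\row_j w (enum_val j)); apply/rowP => i.
transitivity (\sum_(s in L) z s * (s == enum_val i)%:R).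
  rewrite zE (bigD1 i) //= eqxx mulr1 big1 ?addr0 // => l /negbTE li.
  by rewrite (inj_eq enum_val_inj) li mulr0.
rewrite -wP mxE.
under [RHS]eq_bigr => j _ do rewrite mxE mxE.
rewrite -(big_enum_val
  (fun s => w s * simplex_cobd (fun s' => (s' == enum_val i)%:R) s)).
rewrite (big_setID O) /= (setIidPr _); last by apply/subsetP.
rewrite [X in _ + X]big1 ?addr0 // => s /setDP[sL sO].
rewrite /simplex_cobd big1 ?mulr0 // => v vs; case: eqP => // e.
by rewrite (LO s v) // e enum_valP in sO.
Qed.

(** The boundary exchanges even and odd faces. By exactness the kernel of each
    of the two halves is the image of the other, so both numbers of faces equal
    the sum of the two ranks. *)
Lemma exact_even_odd : simplicial_complex L -> exact_complex ->
  #|[set s in L | ~~ odd #|s| ]| = #|[set s in L | odd #|s| ]|.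
Proof.
move=> [_ Lsub] ex; set E := [set s in L | ~~ _]; set O := [set s in L | _].
have sub s v : s \in L -> s :\ v \in L by move=> sL; apply: Lsub sL (subD1set _ _).
have par s v : v \in s -> odd #|s| = ~~ odd #|s :\ v|.
  by move=> vs; rewrite (cardsD1 v s) vs.
have EO s v : s \in E -> v \in s -> s :\ v \in O.
  by rewrite !inE => /andP[sL ps] vs; rewrite sub //= -[odd _]negbK -par.
have OE s v : s \in O -> v \in s -> s :\ v \in E.
  by rewrite !inE => /andP[sL ps] vs; rewrite sub //= -par.
have EL : E \subset L by apply/subsetP => s; rewrite inE => /andP[].
have OL : O \subset L by apply/subsetP => s; rewrite inE => /andP[].
have e1 : (kermx (incidence E O) == incidence O E)%MS.
  apply: incidence_exact => // s v sL vs; rewrite !inE sL /= => /andP[_].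
  by rewrite -par.
have e2 : (kermx (incidence O E) == incidence E O)%MS.
  apply: incidence_exact => // s v sL vs; rewrite !inE sL /= => /andP[_].
  by rewrite (par s v vs) negbK.
move: (eqmx_rank e1) (eqmx_rank e2); rewrite !mxrank_ker => {}e1 {}e2.
rewrite -(subnK (rank_leq_row (incidence E O))) e1.
by rewrite -[RHS](subnK (rank_leq_row (incidence O E))) e2 addnC.
Qed.

End Balance.

(** * Small chains in simplices *)

Section SmallChains.
Variables (R : realType) (T : finType).
Notation X := {ptws T -> R}.
Implicit Types (x y : X) (s : {set T}) (t u : seq X) (c w : seq (seq X)).

Definition close_by (e : R) x y := forall v, `|x v - y v| < e.

Definition cell s x :=
  [/\ forall v, 0 <= x v, \sum_v x v = 1 & forall v, x v != 0 -> v \in s].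

Definition small (e : R) c :=
  forall t x y, t \in c -> x \in t -> y \in t -> close_by e x y.

Definition on_cell s c := forall t x, t \in c -> x \in t -> cell s x.

Definition vertex (v0 : T) : X := fun v => (v == v0)%:R.

Lemma vertex_cell s v : v \in s -> cell s (vertex v).
Proof.
move=> vs; split=> [u||u]; rewrite /vertex ?ler0n //.
  by rewrite (bigD1 v) //= eqxx big1 ?addr0 // => u /negbTE->.
by case: (u =P v) => [->//|_]; rewrite eqxx.
Qed.

Lemma cell_le1 s x v : cell s x -> x v <= 1.
Proof.
by case=> x0 <- _; rewrite (bigD1 v) //= lerDl sumr_ge0.
Qed.

Definition mix (a : R) x y : X := fun v => (1 - a) * x v + a * y v.

Lemma mix_cell s a x y : 0 <= a <= 1 -> cell s x -> cell s y -> cell s (mix a x y).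
Proof.
move=> /andP[a0 a1] [x0 x1 xs] [y0 y1 ys]; split.
- by move=> v; rewrite /mix addr_ge0 // mulr_ge0 // subr_ge0.
- by rewrite /mix big_split /= -!mulr_sumr x1 y1; ring.
- move=> v; apply: contraNT => vs; rewrite /mix.
  have /eqP-> : x v == 0 by apply: contraNT vs; exact: xs.
  have /eqP-> : y v == 0 by apply: contraNT vs; exact: ys.
  by rewrite !mulr0 addr0.
Qed.

(** In a simplex, chains of tuples of small diameter have fillings of small
    diameter, at the price of a factor 2: contract the simplex linearly to one of
    its vertices, in steps shorter than half the allowed diameter. *)
Lemma cell_acyclic s (e : R) (k : nat) c : s != set0 -> 0 < e ->
  cycle_chain c -> on_cell s c -> small (e / 2) c ->
  (forall t, t \in c -> size t = k) ->
  exists2 w, bounds w c &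
   [/\ on_cell s w, small e w & forall t, t \in w -> size t = k.+1].
Proof.
move=> /set0Pn[v vs] e0 cc co cs ck.
have [n nP] := ltr_add_invr (divr_gt0 e0 (ltr0n R 2)).
rewrite add0r in nP.
pose h (j : nat) x := mix (j%:R / n.+1%:R) x (vertex v).
have n1 : 0 < n.+1%:R :> R by rewrite ltr0n.
have h0 t x : t \in c -> x \in t -> h 0 x = x.
  by move=> _ _; apply/funext => u; rewrite /h /mix mul0r subr0 mul1r mul0r addr0.
have h1 t x : t \in c -> x \in t -> h n.+1 x = vertex v.
  move=> _ _; apply/funext => u; rewrite /h /mix divff ?gt_eqF //.
  by rewrite subrr mul0r add0r mul1r.
have [w wb wP] := chain_contraction cc h0 h1.
have hcell j x : (j <= n.+1)%N -> cell s x -> cell s (h j x).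
  move=> jn sx; apply: mix_cell => //; last exact: vertex_cell.
  by rewrite divr_ge0 //= ler_pdivrMr // mul1r ler_nat.
have hclose i j x y : (i <= n.+1)%N -> (j <= n.+1)%N -> (i <= j.+1)%N -> (j <= i.+1)%N ->
    cell s x -> cell s y -> close_by (e / 2) x y -> close_by e (h i x) (h j y).
  move=> il jl ij ji sx sy xy u; rewrite /h /mix.
  set a := _ / _; set b := _ / _; set p := vertex v u.
  have -> : (1 - a) * x u + a * p - ((1 - b) * y u + b * p) =
    (1 - a) * (x u - y u) + (a - b) * (p - y u) by ring.
  apply: le_lt_trans (ler_normD _ _) _; rewrite !normrM.
  have a01 : 0 <= a <= 1.
    by rewrite divr_ge0 //= ler_pdivrMr // mul1r ler_nat.
  have A : `|1 - a| * `|x u - y u| <= `|x u - y u|.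
    by rewrite ler_piMl // ger0_norm ?subr_ge0 ?lerBlDr ?lerDl; case/andP: a01.
  have B : `|a - b| <= n.+1%:R^-1.
    rewrite /a /b -mulrBl normrM [X in _ * X]ger0_norm ?invr_ge0 // ler_piMl ?invr_ge0 //.
    rewrite distrC ler_distl; apply/andP; split.
      by rewrite lerBlDr natr1 ler_nat.
    by rewrite natr1 ler_nat.
  have C : `|p - y u| <= 1.
    have [y0 _ _] := sy; have y1 := cell_le1 u sy; have {}y0 := y0 u.
    have pc := vertex_cell vs.
    have p1 : p <= 1 := cell_le1 u pc.
    have p0 : 0 <= p by case: pc => p0 _ _; exact: p0.
    by rewrite ler_norml; apply/andP; split; lra.
  have D : `|a - b| * `|p - y u| <= n.+1%:R^-1.
    apply: le_trans B; exact: ler_piMr.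
  by rewrite [e]splitr; apply: le_lt_trans (lerD A D) (ltrD (xy u) nP).
exists w => //; split.
- move=> u x /wP[t tc [_ [hb|[j jm hj]]]].
    by move=> /hb->; exact: vertex_cell.
  move=> /hj[y yt [->|->]]; apply: hcell; rewrite ?(ltnW jm) //; exact: co yt.
- move=> u x y /wP[t tc [_ [hb|[j jm hj]]]].
    by move=> /hb-> /hb-> z; rewrite subrr normr0.
  move=> /hj[x' xt hx] /hj[y' yt hy].
  have [cx cy] := (co _ _ tc xt, co _ _ tc yt).
  have cxy := cs _ _ _ tc xt yt.
  by case: hx => ->; case: hy => ->; apply: hclose; rewrite // ?(ltnW jm) ?leqnSn // ltnW.
- by move=> u /wP[t tc [-> _]]; rewrite ck.
Qed.

(** The chain replacing a face is built by induction on its number of vertices: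
    the chains replacing its facets add up to a cycle of the closed face, which
    is filled there. Each filling doubles the diameter, hence an induction
    hypothesis for all bounds at once. *)
Lemma subdivision (k : nat) (e : R) : 0 < e ->
  exists Sd : {set T} -> seq (seq X), Sd set0 = [:: [::]] /\
    forall s, (#|s| <= k)%N ->
      [/\ forall f, \sum_(t <- Sd s) tuple_cobd f t =
            \sum_(v in s) \sum_(t <- Sd (s :\ v)) f t,
          forall t, t \in Sd s -> size t = #|s|,
          on_cell s (Sd s) & small e (Sd s)].
Proof.
elim: k e => [|k IH] e e0.
  exists (fun _ => [:: [::]]); split=> // s; rewrite leqn0 cards_eq0 => /eqP->.
  split.
  - by move=> f; rewrite big_seq1 big_set0.
  - by move=> t; rewrite inE cards0 => /eqP->.
  - by move=> t x; rewrite inE => /eqP->.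
  - by move=> t x y; rewrite inE => /eqP->.
have e20 : 0 < e / 2 by rewrite divr_gt0.
have [Sd [Sd0 SdP]] := IH _ e20.
pose bd s := flatten [seq Sd (s :\ v) | v <- enum s].
have bdE s (f : seq X -> 'F_2) :
    \sum_(t <- bd s) f t = \sum_(v in s) \sum_(t <- Sd (s :\ v)) f t.
  by rewrite big_flatten big_map big_enum.
have card_rem s v : #|s| = k.+1 -> v \in s -> #|(s :\ v)| = k.
  by move=> sk vs; move: (cardsD1 v s); rewrite vs sk add1n => -[].
have bdP s : #|s| = k.+1 -> exists w, bounds w (bd s) /\
    [/\ on_cell s w, small e w & forall t, t \in w -> size t = k.+1].
  move=> sk.
  have bd_in t : t \in bd s -> exists2 v, v \in s & t \in Sd (s :\ v).
    by move=> /flatten_mapP[v]; rewrite mem_enum => vs tv; exists v.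
  have s0 : s != set0 by rewrite -cards_eq0 sk.
  have [] := @cell_acyclic s e k (bd s) s0 e0.
  - move=> f; rewrite bdE.
    rewrite -[RHS](simplex_cobd_cobd (fun s' => \sum_(t <- Sd s') f t) s).
    apply: eq_bigr => v vs; have [|-> //] := SdP (s :\ v).
    by rewrite card_rem.
  - move=> t x /bd_in[v vs tv] xt; have [|_ _ h _] := SdP (s :\ v).
      by rewrite card_rem.
    have [x0 x1 x2] := h _ _ tv xt; split=> // z /x2.
    by rewrite inE => /andP[].
  - move=> t x y /bd_in[v vs tv]; have [|_ _ _ h] := SdP (s :\ v).
      by rewrite card_rem.
    exact: h.
  - move=> t /bd_in[v vs tv]; have [|_ st _ _] := SdP (s :\ v).
      by rewrite card_rem.
    by rewrite st // card_rem.
  - by move=> w wb wP; exists w.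
have /choice[g gP] : forall s, exists w, #|s| = k.+1 -> bounds w (bd s) /\
    [/\ on_cell s w, small e w & forall t, t \in w -> size t = k.+1].
  move=> s; case: (#|s| =P k.+1) => [/bdP[w wP]|]; first by exists w.
  by exists [::].
exists (fun s => if #|s| == k.+1 then g s else Sd s); split.
  by rewrite cards0.
move=> s; rewrite leq_eqVlt ltnS => /orP[sk|sk].
  rewrite sk; move/eqP in sk; have [gb [gc gs gk]] := gP _ sk.
  split=> //; last by move=> t /gk->; rewrite sk.
  move=> f; rewrite gb bdE; apply: eq_bigr => v vs.
  by rewrite card_rem // ltn_eqF.
have [h1 h2 h3 h4] := SdP _ sk.
have -> : (#|s| == k.+1) = false by rewrite ltn_eqF.
split=> // [f|t x y tS xt yt z]; last first.
  apply: lt_le_trans (h4 _ _ _ tS xt yt z) _; lra.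
rewrite h1; apply: eq_bigr => v vs.
by rewrite ltn_eqF // ltnS (leq_trans _ sk) // subset_leq_card // subD1set.
Qed.

End SmallChains.

(** * Complexes with contractible realization *)

Section Contractible.
Variables (R : realType) (T : finType) (L : {set {set T}}).
Notation X := {ptws T -> R}.
Implicit Types (x y : X) (s : {set T}) (t u : seq X) (c w : seq (seq X)).
Notation "|L|" := (@geometric_realization R T L).

Definition supp x : {set T} := [set v | x v != 0]%SET.

(** A contraction of |L| to [b], its continuity being stated as uniform
    continuity in coordinates. *)
Definition uniform_contraction (H : R -> X -> X) (b : X) :=
  [/\ |L| b, forall x, |L| x -> H 0 x = x, forall x, |L| x -> H 1 x = b,
      forall (a : R) x, 0 <= a <= 1 -> |L| x -> |L| (H a x) &
      forall d : R, 0 < d -> exists2 e : R, 0 < e & forall (a a' : R) x x',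
        0 <= a <= 1 -> 0 <= a' <= 1 -> |L| x -> |L| x' ->
        `|a - a'| < e -> close_by e x x' -> close_by d (H a x) (H a' x')].

Lemma large_coordinate x : |L| x -> exists v, #|T|%:R^-1 <= x v.
Proof.
move=> [x0 x1 _]; apply/existsP; apply: contraT; rewrite negb_exists => /forallP xv.
have /card_gt0P[v0 _] : (0 < #|T|)%N.
  rewrite lt0n; apply/eqP => /card0_eq T0; move: x1; rewrite big_pred0 //.
  by move=> /eqP; rewrite eq_sym oner_eq0.
have : \sum_v x v < \sum_(v : T) (#|T|%:R^-1 : R).
  apply: ltr_sum; first by apply/hasP; exists v0 => //; rewrite mem_index_enum.
  by move=> v _; rewrite ltNge xv.
rewrite x1 sumr_const -[X in _ < X]mulr_natl divff ?ltxx //.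
by rewrite pnatr_eq0 -lt0n; apply/card_gt0P; exists v0.
Qed.

(** A cycle is replaced by a chain of tuples so small that the contraction, cut
    into short steps, fills it with tuples of diameter less than 1/|T|. Sending
    a point to a vertex where its coordinate is at least 1/|T| turns such a tuple
    into vertices of the support of any of its points, hence into a simplex of L.
    This brings the filling back to L, and the replaced cycle to the original
    one. *)
Lemma contractible_exact H b :
  simplicial_complex L -> uniform_contraction H b ->
  exact_complex L.
Proof.
move=> [L0 Lsub] [Lb H0 H1 HL Hunif] z zc.
have [v0 _] := large_coordinate Lb.
have T0 : 0 < #|T|%:R :> R by rewrite ltr0n; apply/card_gt0P; exists v0.
pose phi x := odflt v0 [pick v | #|T|%:R^-1 <= x v].
have phiP x : |L| x -> #|T|%:R^-1 <= x (phi x).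
  move=> /large_coordinate[v vx]; rewrite /phi; case: pickP => //= /(_ v).
  by rewrite vx.
have d0 : 0 < #|T|%:R^-1 :> R by rewrite invr_gt0.
have phi_close x y : |L| x -> close_by (#|T|%:R^-1) x y -> phi x \in supp y.
  move=> Lx /(_ (phi x)); rewrite inE; apply: contraTneq => ->.
  rewrite subr0 -leNgt ger0_norm ?phiP //; by case: Lx.
have cellL s x : s \in L -> cell s x -> |L| x.
  move=> sL [x0 x1 xs]; split=> //; apply: (Lsub s) => //.
  by apply/subsetP => v; rewrite inE; exact: xs.
have phi_cell s x : s \in L -> cell s x -> phi x \in s.
  move=> sL sx; have := phi_close x x (cellL _ _ sL sx).
  rewrite inE => h; have [_ _ -> //] := sx; apply: h => v.
  by rewrite subrr normr0.
have [e e0 He] := Hunif _ d0.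
have [n nP] := ltr_add_invr e0; rewrite add0r in nP.
have [Sd [Sd0 SdP]] := subdivision T #|T| e0.
have {}SdP s := SdP s (max_card _).
(* the chain replacing a face comes back to a multiple of this face, and the
   multiple is 1 by comparison of boundaries *)
have SdK s f : s \in L -> \sum_(t <- Sd s) tuple_value f (map phi t) = f s.
  have [k] := ubnP #|s|; elim: k s f => // k IH s f; rewrite ltnS => sk sL.
  have [Sd1 Sd2 Sd3 Sd4] := SdP s.
  pose N := \sum_(t <- Sd s) (uniq (map phi t))%:R : 'F_2.
  have SdN g : \sum_(t <- Sd s) tuple_value g (map phi t) = N * g s.
    rewrite /N mulr_suml; apply: eq_big_seq => t tS; rewrite /tuple_value.
    case: ifP => ut; rewrite ?mul0r // mul1r; congr (g _); apply/eqP.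
    rewrite eqEcard; apply/andP; split.
      apply/subsetP => v; rewrite inE => /mapP[x xt ->].
      exact: phi_cell (Sd3 _ _ tS xt).
    by rewrite -(Sd2 t tS) -(size_map phi) -(card_uniqP ut) cardsE.
  rewrite SdN; have [s0|/set0Pn[v vs]] := eqVneq s set0.
    by rewrite /N s0 Sd0 big_seq1 mul1r.
  pose g s' : 'F_2 := (s' == s :\ v)%:R.
  have gE : simplex_cobd g s = 1.
    rewrite /simplex_cobd (bigD1 v) //= /g eqxx big1 ?addr0 // => u /andP[us uv].
    case: eqP => // /setP/(_ u); by rewrite !inE eqxx uv us.
  suff -> : N = 1 by rewrite mul1r.
  rewrite -[LHS]mulr1 -gE -SdN.
  have -> : \sum_(t <- Sd s) tuple_value (simplex_cobd g) (map phi t) =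
    \sum_(t <- Sd s) tuple_cobd (fun t => tuple_value g (map phi t)) t.
    by apply: eq_bigr => t _; rewrite -tuple_cobd_map tuple_cobd_value.
  rewrite Sd1; apply: eq_bigr => u us; apply: IH.
    by apply: leq_trans sk; rewrite [X in (_ < X)%N](cardsD1 u) us.
  by apply: Lsub sL _; exact: subD1set.
pose Z := [seq s <- enum L | z s == 1].
have ZE (g : {set T} -> 'F_2) : \sum_(s <- Z) g s = \sum_(s in L) z s * g s.
  rewrite big_filter big_enum_cond [RHS](bigID (fun s => z s == 1)) /=.
  rewrite [X in _ + X]big1 ?addr0.
    by apply: eq_bigr => s /andP[_ /eqP->]; rewrite mul1r.
  move=> s /andP[_]; have : z s = 0 \/ z s = 1.
    case: (z s) => [[|[|//]]] i; [left|right]; exact: val_inj.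
  by case=> ->; rewrite ?mul0r ?eqxx.
have ZL s : s \in Z -> s \in L by rewrite mem_filter mem_enum => /andP[].
pose c := flatten [seq Sd s | s <- Z].
have cP t : t \in c -> exists2 s, s \in L & t \in Sd s.
  by move=> /flatten_mapP[s /ZL sL ts]; exists s.
have cyc : cycle_chain c.
  move=> f; rewrite big_flatten big_map.
  rewrite -[RHS](zc (fun s' => \sum_(t <- Sd s') f t)) -ZE.
  by apply: eq_bigr => s _; have [-> _ _ _] := SdP s.
have cL t x : t \in c -> x \in t -> |L| x.
  move=> /cP[s sL ts] xt; apply: cellL sL _; have [_ _ h _] := SdP s; exact: h ts xt.
have n1 : 0 < n.+1%:R :> R by rewrite ltr0n.
pose h (j : nat) x := H (j%:R / n.+1%:R) x.
have h0 t x : t \in c -> x \in t -> h 0 x = x.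
  by move=> tc xt; rewrite /h mul0r H0 //; exact: cL xt.
have h1 t x : t \in c -> x \in t -> h n.+1 x = b.
  by move=> tc xt; rewrite /h divff ?gt_eqF // H1 //; exact: cL xt.
have [w wb wP] := chain_contraction cyc h0 h1.
have wL u x : u \in w -> x \in u -> |L| x.
  move=> /wP[t tc [_ [ub|[j jn uj]]]]; first by move=> /ub->.
  move=> /uj[y yt [->|->]]; apply: HL; try exact: (cL _ _ tc yt);
    by rewrite divr_ge0 //= ler_pdivrMr // mul1r ler_nat // ltnW.
have wclose u x y : u \in w -> x \in u -> y \in u -> close_by (#|T|%:R^-1) x y.
  move=> /wP[t tc [_ [ub|[j jn uj]]]].
    by move=> /ub-> /ub-> v; rewrite subrr normr0.
  have tclose x' y' : x' \in t -> y' \in t -> close_by e x' y'.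
    by have [s sL ts] := cP _ tc; have [_ _ _ sm] := SdP s; exact: sm.
  have j1 : 0 <= (j%:R / n.+1%:R : R) <= 1.
    by rewrite divr_ge0 //= ler_pdivrMr // mul1r ler_nat // ltnW.
  have j2 : 0 <= (j.+1%:R / n.+1%:R : R) <= 1.
    by rewrite divr_ge0 //= ler_pdivrMr // mul1r ler_nat // ltnW.
  have jj : `|j%:R / n.+1%:R - j.+1%:R / n.+1%:R : R| < e.
    rewrite -mulrBl -natr1 opprD addrA subrr add0r mulN1r normrN.
    by rewrite ger0_norm // invr_ge0.
  move=> /uj[x' xt hx] /uj[y' yt hy].
  have [Lx Ly] := (cL _ _ tc xt, cL _ _ tc yt); have xy := tclose _ _ xt yt.
  case: hx => ->; case: hy => ->; apply: He => //;
    by rewrite ?subrr ?normr0 // distrC.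
pose im u := [set v in map phi u]%SET.
have wim u : u \in w -> im u \in L.
  case: u => [|x u] uw.
    by rewrite (_ : im [::] = set0) //; apply/setP => v; rewrite !inE.
  have [_ _ sL] := wL _ _ uw (mem_head x u); apply: Lsub sL _.
  apply/subsetP => v; rewrite /im [v \in _]inE => /mapP[y yu ->].
  apply: phi_close; first exact: wL uw yu.
  by apply: wclose uw yu _; exact: mem_head.
exists (fun s => \sum_(u <- w | im u == s) (uniq (map phi u))%:R) => f.
transitivity (\sum_(u <- w) tuple_value (simplex_cobd f) (map phi u)).
  under eq_bigr => s _ do rewrite mulr_suml big_mkcond /=.
  rewrite exchange_big /=; apply: eq_big_seq => u uw.
  rewrite (bigD1 (im u)) ?wim //= eqxx big1 => [|s /andP[_ /negbTE]]; last first.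
    by rewrite eq_sym => ->.
  by rewrite addr0 /tuple_value; case: ifP; rewrite ?mul1r ?mul0r.
under eq_bigr => u _ do rewrite -tuple_cobd_value tuple_cobd_map.
rewrite wb -ZE big_flatten big_map; apply: eq_big_seq => s /ZL sL.
exact: SdK.
Qed.
End Contractible.

(** * Punctured spheres *)

Definition deletion (T : finType) (K : {set {set T}}) (tau : {set T}) :=
  [set s in K | ~~ (tau \subset s)].

Section PuncturedSphere.
Local Open Scope classical_set_scope.

Section Sphere.
Variable R : realType.
Implicit Types (a : R) (y q : 'rV[R]_4).

Definition sqnorm y := \sum_(i < 4) y 0 i ^+ 2.

(** Great arcs from [y] to the antipode of [q]: the chord, projected radially. *)
Definition slide q a y : 'rV[R]_4 :=
  (Num.sqrt (sqnorm ((1 - a) *: y - a *: q)))^-1 *: ((1 - a) *: y - a *: q).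

Lemma sqnormZ a y : sqnorm (a *: y) = a ^+ 2 * sqnorm y.
Proof. by rewrite /sqnorm mulr_sumr; apply: eq_bigr => i _; rewrite mxE exprMn. Qed.

Lemma sqnorm_ge0 y : 0 <= sqnorm y.
Proof. by apply: sumr_ge0 => i _; exact: sqr_ge0. Qed.

Lemma sqnorm_eq0 y : sqnorm y = 0 -> y = 0.
Proof.
move=> /eqP; rewrite psumr_eq0 => [/allP h|i _]; last exact: sqr_ge0.
apply/rowP => i; have := h i; rewrite mem_index_enum sqrf_eq0 => /(_ isT)/eqP->.
by rewrite mxE.
Qed.

Lemma sphere_ray y q b c : sphere3 y -> sphere3 q -> 0 <= b -> 0 <= c ->
  b *: y = c *: q -> b = c.
Proof.
move=> ys qs b0 c0 /(congr1 sqnorm); rewrite !sqnormZ.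
rewrite (_ : sqnorm y = 1) // (_ : sqnorm q = 1) // !mulr1 => /eqP.
by rewrite eqrXn2 // => /eqP.
Qed.

(** The chord from [y] to [- q] avoids the origin, for it could only pass through
    it at its midpoint, and then y = q. *)
Lemma chord_neq0 q a y : sphere3 y -> sphere3 q -> y <> q -> 0 <= a <= 1 ->
  0 < sqnorm ((1 - a) *: y - a *: q).
Proof.
move=> ys qs yq /andP[a0 a1]; rewrite lt0r sqnorm_ge0 andbT; apply/eqP.
move=> /sqnorm_eq0/eqP; rewrite subr_eq0 => /eqP e.
have a1' : 0 <= 1 - a by rewrite subr_ge0.
have ea := sphere_ray ys qs a1' a0 e; apply: yq.
have an0 : a != 0.
  by apply/eqP => a00; move: ea; rewrite a00 subr0 => /eqP; rewrite oner_eq0.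
by rewrite ea in e; apply: scalerI e.
Qed.

(** A point of the chord positively proportional to [q] would make [y] positively
    proportional to [q] as well. *)
Lemma slide_sphere q a y : sphere3 y -> sphere3 q -> y <> q -> 0 <= a <= 1 ->
  sphere3 (slide q a y) /\ slide q a y <> q.
Proof.
move=> ys qs yq a01; have h := chord_neq0 ys qs yq a01; split.
  rewrite /sphere3 /= -/(sqnorm (slide q a y)) /slide sqnormZ exprVn sqr_sqrtr ?ltW //.
  by rewrite mulVf // gt_eqF.
rewrite /slide; set n := sqnorm _ in h *; rewrite scalerBr !scalerA => /eqP.
have c0 : 0 < (Num.sqrt n)^-1 by rewrite invr_gt0 sqrtr_gt0.
move: c0; move: (Num.sqrt n)^-1 => c c0; case/andP: a01 => a0 a1.
rewrite subr_eq -[X in _ == X + _]scale1r -scalerDl => /eqP e.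
have b0 : 0 <= c * (1 - a) by rewrite mulr_ge0 ?subr_ge0 // ltW.
have d0 : 0 <= 1 + c * a by rewrite addr_ge0 // mulr_ge0 // ltW.
have ea := sphere_ray ys qs b0 d0 e; apply: yq; rewrite ea in e.
by apply: scalerI e; rewrite gt_eqF // ltr_pwDl // mulr_ge0 // ltW.
Qed.

Lemma slide0 q y : sphere3 y -> slide q 0 y = y.
Proof.
move=> ys; rewrite /slide subr0 scale1r scale0r subr0 (_ : sqnorm y = 1) //.
by rewrite sqrtr1 invr1 scale1r.
Qed.

Lemma slide1 q y : slide q 1 y = slide q 1 q.
Proof. by rewrite /slide subrr !scale0r. Qed.

Lemma rV_cvg (Z : Type) (F : set_system Z) (FF : Filter F) n
    (u : Z -> 'rV[R]_n) (y : 'rV[R]_n) :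
  (forall i, u z 0 i @[z --> F] --> y 0 i) -> u @ F --> y.
Proof.
move=> h A [P Py PA]; rewrite /nbhs /=.
apply: filterS (_ : \forall z \near F, forall j, P 0 j (u z 0 j)).
  by move=> z hz; apply: PA => i j; rewrite ord1.
by apply: filter_forall => j; exact: h (Py 0 j).
Qed.

Lemma slide_cvg (Z : Type) (F : set_system Z) (FF : Filter F) (a : Z -> R)
    (u : Z -> 'rV[R]_4) a0 y0 q :
  a @ F --> a0 -> u @ F --> y0 -> 0 < sqnorm ((1 - a0) *: y0 - a0 *: q) ->
  slide q (a z) (u z) @[z --> F] --> slide q a0 y0.
Proof.
move=> ca cu h.
have cu' i : u z 0 i @[z --> F] --> y0 0 i.
  exact: (@cvg_comp _ _ _ u (fun M : 'rV[R]_4 => M 0 i) F _ _ cu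
    (@coord_continuous R 1 4 0 i y0)).
have cc i : ((1 - a z) *: u z - a z *: q) 0 i @[z --> F] -->
    ((1 - a0) *: y0 - a0 *: q) 0 i.
  rewrite !mxE.
  under eq_cvg do rewrite !mxE.
  apply: cvgB; first by apply: cvgM => //; apply: cvgB => //; exact: cvg_cst.
  by apply: cvgM => //; exact: cvg_cst.
have cs : (Num.sqrt (sqnorm ((1 - a z) *: u z - a z *: q)))^-1 @[z --> F] -->
  (Num.sqrt (sqnorm ((1 - a0) *: y0 - a0 *: q)))^-1.
  apply: cvgV; first by rewrite gt_eqF // sqrtr_gt0.
  apply: (@cvg_comp _ _ _ (fun z => sqnorm ((1 - a z) *: u z - a z *: q)) Num.sqrt
    F _ _ _ (@sqrt_continuous R _)).
  apply: cvg_big; first exact: add_continuous.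
  by move=> i _; apply: cvgM.
apply: rV_cvg => i; rewrite [X in _ --> X]mxE.
under eq_cvg do rewrite mxE.
exact: cvgM.
Qed.

End Sphere.

(** Compactness of D x D: near the diagonal the continuity of [G] suffices, and
    away from it some coordinate separates the two points by more than [e], so
    there is nothing to prove. *)
Lemma uniform_on_compact (R : realType) (Z : topologicalType) (I J : finType)
    (D : set Z) (rho : I -> Z -> R) (G : Z -> J -> R) :
  compact D -> (forall i, continuous (rho i)) ->
  (forall z z', D z -> D z' -> (forall i, rho i z = rho i z') -> z = z') ->
  (forall z j, D z -> G z' j @[z' --> within D (nbhs z)] --> G z j) ->
  forall d : R, 0 < d -> exists2 e : R, 0 < e & forall z z', D z -> D z' ->
    (forall i, `|rho i z - rho i z'| < e) -> forall j, `|G z j - G z' j| < d.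
Proof.
move=> cD rhoc sep Gc d d0.
have := compact_setX cD cD => /compact_near_coveringP/near_covering_withinP.
pose P (e : R) (w : Z * Z) := (forall i, `|rho i w.1 - rho i w.2| < e) ->
    forall j, `|G w.1 j - G w.2 j| < d.
move=> cover.
have cov : \forall e \near 0^'+, D `*` D `<=` P e.
  apply: cover => -[z0 z1] [/= Dz0 Dz1].
  have [zz|zz] := pselect (forall i, rho i z0 = rho i z1).
    have {z1 Dz1 zz} <- := sep _ _ Dz0 Dz1 zz.
    have N : \forall z \near z0, D z -> forall j, `|G z0 j - G z j| < d / 2.
      suff : \forall z \near within D (nbhs z0), forall j, `|G z0 j - G z j| < d / 2.
        by [].
      apply: filter_forall => j.
      have d20 : 0 < d / 2 by rewrite divr_gt0.
      by have /cvgrPdist_lt/(_ _ d20) := Gc z0 j Dz0.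
    have N1 : \forall w \near (z0, z0), D w.1 -> forall j, `|G z0 j - G w.1 j| < d / 2.
      exact: (cvg_fst N).
    have N2 : \forall w \near (z0, z0), D w.2 -> forall j, `|G z0 j - G w.2 j| < d / 2.
      exact: (cvg_snd N).
    near=> w e => -[Dw1 Dw2] _ j.
    have h1 : `|G z0 j - G w.1 j| < d / 2.
      have h : D w.1 -> forall j, `|G z0 j - G w.1 j| < d / 2 by near: w.
      exact: h.
    have h2 : `|G z0 j - G w.2 j| < d / 2.
      have h : D w.2 -> forall j, `|G z0 j - G w.2 j| < d / 2 by near: w.
      exact: h.
    rewrite (_ : _ - _ = (G z0 j - G w.2 j) - (G z0 j - G w.1 j)); last by ring.
    by rewrite [d]splitr (le_lt_trans (ler_normB _ _)) // ltrD.
  have /existsNP[i zi] := zz.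
  pose g := `|rho i z0 - rho i z1|.
  have g0 : 0 < g by rewrite normr_gt0 subr_eq0; apply/eqP.
  have g30 : 0 < g / 3 by rewrite divr_gt0.
  have N1 : \forall w \near (z0, z1), `|rho i z0 - rho i w.1| < g / 3.
    apply: (cvg_fst (_ : \forall z \near z0, `|rho i z0 - rho i z| < g / 3)).
    by have /cvgrPdist_lt/(_ _ g30) := rhoc i z0.
  have N2 : \forall w \near (z0, z1), `|rho i z1 - rho i w.2| < g / 3.
    apply: (cvg_snd (_ : \forall z \near z1, `|rho i z1 - rho i z| < g / 3)).
    by have /cvgrPdist_lt/(_ _ g30) := rhoc i z1.
  near=> w e => _ /(_ i) we j; exfalso.
  have h1 : `|rho i z0 - rho i w.1| < g / 3 by near: w.
  have h2 : `|rho i z1 - rho i w.2| < g / 3 by near: w.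
  have h3 : e < g / 3 by near: e; exact: nbhs_right_lt.
  have h4 : `|rho i w.1 - rho i w.2| < g / 3 by exact: lt_trans we h3.
  suff : g < g by rewrite ltxx.
  rewrite {1}/g (_ : _ - _ = (rho i z0 - rho i w.1) + (rho i w.1 - rho i w.2)
     - (rho i z1 - rho i w.2)); last by ring.
  apply: le_lt_trans (ler_normB _ _) _.
  apply: le_lt_trans (lerD (ler_normD _ _) (lexx _)) _.
  by have := ltrD (ltrD h1 h4) h2; congr (_ < _); field.
near (0 : R)^'+ => e.
have Pe : D `*` D `<=` P e by near: e.
exists e; first by near: e; exact: nbhs_right_gt.
by move=> z z' Dz Dz'; apply: (Pe (z, z')).
Unshelve. all: by end_near.
Qed.

Lemma within_comp (Z : Type) (U V : topologicalType) (F : set_system Z)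
    (FF : Filter F) (A : set U) (u : Z -> U) (f : U -> V) x :
  u @ F --> x -> (\forall z \near F, A (u z)) ->
  f @ within A (nbhs x) --> f x -> f (u z) @[z --> F] --> f x.
Proof.
move=> ux uA fx W /fx fW.
have h : \forall z \near F, A (u z) -> W (f (u z)) := ux _ fW.
by apply: filterS2 h uA => z h /h.
Qed.

Section Realization.
Variables (R : realType) (T : finType).
Notation X := {ptws T -> R}.
Implicit Types (x y : X) (s : {set T}) (L : {set {set T}}).
Notation realiz L := (@geometric_realization R T L).

Lemma coord_cont (v : T) : continuous (fun x : X => x v).
Proof. exact: (@proj_continuous T (fun=> R) v). Qed.

Lemma near_coord_neq (F : set_system X) (FF : Filter F) (m : X -> R) x (c : R) :
  m @ F --> m x -> m x != c -> \forall y \near F, m y != c.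
Proof.
move=> mF mc; have : \forall r \near m x, r != c.
  have : open [set r : R | r != c].
    rewrite (_ : [set r : R | r != c] = ~` [set c]).
      by apply: closed_openC; exact: closed_eq.
    by apply/seteqP; split => r /= /eqP.
  by move=> op; exact: (open_nbhs_nbhs (conj op mc)).
exact: mF.
Qed.

Lemma realization_closed L : simplicial_complex L -> closed (realiz L).
Proof.
move=> [L0 Lsub]; rewrite -openC openE => x /= nx.
have sum_cont : continuous (fun y : X => \sum_v y v).
  apply: (@continuous_big R T +%R 0 xpredT (@add_continuous R) X (index_enum T)
    (fun v (y : X) => y v)) => v _; exact: coord_cont.
have [x0|/existsNP[v xv]] := pselect (forall v, 0 <= x v); last first.
  have {xv} xv : x v < 0 by rewrite ltNge; apply/negP.
  have : \forall y \near x, y v < 0 by have := @coord_cont v x; move/cvgr_lt; apply.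
  by apply: filterS => y yv [/(_ v)]; rewrite leNgt yv.
have [x1|x1] := eqVneq (\sum_v x v) 1; last first.
  apply: filterS (near_coord_neq _ (sum_cont x) x1) => y /eqP y1.
  by move=> [_ /y1].
have xs : supp x \notin L by apply/negP => xL; apply: nx.
have : \forall y \near x, forall v, x v != 0 -> y v != 0.
  apply: (@filter_forall X T (fun v (y : X) => x v != 0 -> y v != 0) (nbhs x) _).
  move=> v; have [xv|xv] := eqVneq (x v) 0.
    by apply: filterE => y /eqP xv0; case: xv0.
  by apply: filterS (near_coord_neq _ (@coord_cont v x) xv).
apply: filterS => y h [_ _ yL]; move/negP: xs; apply.
by apply: Lsub yL _; apply/subsetP => v; rewrite !inE; exact: h.
Qed.

Lemma realization_le1 L x v : realiz L x -> x v <= 1.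
Proof.
by case=> x0 <- _; rewrite (bigD1 v) //= lerDl sumr_ge0.
Qed.

Lemma realization_compact L : simplicial_complex L -> compact (realiz L).
Proof.
move=> /realization_closed cL.
have cb := @tychonoff T (fun=> R) (fun=> `[0, 1]%classic) (fun=> @segment_compact R 0 1).
apply: subclosed_compact cL cb _ => x Lx v /=.
by rewrite in_itv /= (realization_le1 _ Lx); case: Lx => ->.
Qed.

Variable tau : {set T}.

Definition min_on x : R := \big[Num.min/1]_(v in tau) x v.

(** Pushing away from the barycenter of [tau]: subtract the largest multiple of the
    indicator of [tau] that leaves nonnegative coordinates, then normalize. *)
Definition push x : X :=
  fun v => (x v - (v \in tau)%:R * min_on x) / (1 - #|tau|%:R * min_on x).

Definition barycenter : X := fun v => (v \in tau)%:R / #|tau|%:R.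

Lemma min_on_cont : continuous min_on.
Proof.
have min_cont : continuous (fun z : R * R => Num.min z.1 z.2).
  move=> z; apply: (@continuous_min _ _ (fun z : R * R => z.1) (fun z => z.2)).
    exact: cvg_fst.
  exact: cvg_snd.
apply: (@continuous_big R T Num.min 1 (mem tau) min_cont X (index_enum T)
  (fun v (y : X) => y v)) => v _; exact: coord_cont.
Qed.

Lemma min_on_le x v : v \in tau -> min_on x <= x v.
Proof. by move=> vt; rewrite /min_on (bigD1 v) //= ge_min lexx. Qed.

Hypothesis tau0 : tau != set0.

Lemma min_on_attained L x : realiz L x -> exists2 v, v \in tau & min_on x = x v.
Proof.
move=> Lx; have [v0 v0t] := set0Pn _ tau0.
have [v vt vmin] := @arg_minP _ _ _ v0 (mem tau) x v0t.
exists v => //; apply/le_anti; rewrite min_on_le //=.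
rewrite /min_on; elim/big_ind: _ => [|a b ha hb|u ut].
- exact: realization_le1 Lx.
- by rewrite le_min ha.
- exact: vmin.
Qed.

Variables (K : {set {set T}}) (hK : simplicial_complex K) (tauK : tau \in K).

Lemma deletion_complex : simplicial_complex (deletion K tau).
Proof.
have [K0 Ksub] := hK; split; first by rewrite inE K0 subset0.
move=> s t; rewrite !inE => /andP[sK ns] ts; rewrite (Ksub _ _ sK ts) /=.
by apply: contra ns => /subset_trans; apply.
Qed.

Lemma deletion_sub x : realiz (deletion K tau) x -> realiz K x.
Proof. by case=> x0 x1; rewrite inE => /andP[xs _]. Qed.

Let tau_gt0 : 0 < #|tau|%:R :> R.
Proof. by rewrite ltr0n card_gt0. Qed.

Lemma sum_indicator : \sum_v (v \in tau)%:R = #|tau|%:R :> R.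
Proof.
rewrite -sum1_card natr_sum [RHS]big_mkcond /=.
by apply: eq_bigr => v _; case: (v \in tau).
Qed.

Lemma barycenter_in : realiz K barycenter.
Proof.
split.
- by move=> v; rewrite divr_ge0.
- by rewrite /barycenter -mulr_suml sum_indicator divff // gt_eqF.
- rewrite (_ : [set v | _]%SET = tau) //; apply/setP => v; rewrite inE /barycenter.
  by rewrite mulf_eq0 invr_eq0 (gt_eqF tau_gt0) orbF pnatr_eq0 eqb0 negbK.
Qed.

Lemma deletion_barycenter x : realiz (deletion K tau) x -> x <> barycenter.
Proof.
move=> [_ _]; rewrite inE => /andP[_ xs] e; move/negP: xs; apply.
apply/subsetP => v vt; rewrite inE e /barycenter vt mul1r invr_eq0.
by rewrite gt_eqF.
Qed.

Lemma sum_tau x : \sum_v ((v \in tau)%:R * min_on x) = #|tau|%:R * min_on x.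
Proof. 
by rewrite -mulr_suml sum_indicator.
Qed.

Lemma push_num_ge0 x v : realiz K x -> 0 <= x v - (v \in tau)%:R * min_on x.
Proof.
move=> Kx; case: (boolP (v \in tau)) => vt; first by rewrite mul1r subr_ge0 min_on_le.
by rewrite mul0r subr0; case: Kx.
Qed.

(** The denominator is the sum of the numerators, which are nonnegative and vanish
    together only at the barycenter. *)
Lemma push_den_gt0 x : realiz K x -> x <> barycenter -> 0 < 1 - #|tau|%:R * min_on x.
Proof.
move=> Kx xb; have [_ x1 _] := Kx.
have S : \sum_v (x v - (v \in tau)%:R * min_on x) = 1 - #|tau|%:R * min_on x.
  by rewrite sumrB x1 sum_tau.
rewrite lt0r -S sumr_ge0 ?andbT => [|v _]; last exact: push_num_ge0.
apply/eqP => /eqP; rewrite psumr_eq0 => [/allP h|v _]; last exact: push_num_ge0.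
apply: xb; apply/funext => v.
have xv u : x u = (u \in tau)%:R * min_on x.
  by apply/eqP; rewrite -subr_eq0; apply: h; rewrite mem_index_enum.
have e : #|tau|%:R * min_on x = 1.
  rewrite -sum_tau; apply: etrans x1; apply: eq_bigr => u _.
  exact: esym (xv u).
rewrite xv /barycenter; congr (_ * _).
by apply: (mulfI (lt0r_neq0 tau_gt0)); rewrite e divff // gt_eqF.
Qed.

(** A coordinate of [tau] where the minimum is attained becomes 0. *)
Lemma push_in x : realiz K x -> x <> barycenter -> realiz (deletion K tau) (push x).
Proof.
move=> Kx xb; have d0 := push_den_gt0 Kx xb; have [x0 x1 xK] := Kx; split.
- by move=> v; rewrite divr_ge0 ?push_num_ge0 // ltW.
- by rewrite /push -mulr_suml sumrB x1 sum_tau divff // gt_eqF.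
have num v : push x v != 0 -> x v != (v \in tau)%:R * min_on x.
  by apply: contraNN => /eqP e; rewrite /push e subrr mul0r.
have [_ Ksub] := hK; rewrite inE; apply/andP; split.
  apply: Ksub xK _; apply/subsetP => v; rewrite !inE => /num.
  apply: contraNN => /eqP xv; rewrite xv eq_sym.
  case: (boolP (v \in tau)) => vt; rewrite ?mul0r // mul1r.
  by rewrite eq_le -{1}xv min_on_le //=; have [u ut ->] := min_on_attained Kx.
apply/negP => /subsetP ts; have [v vt mv] := min_on_attained Kx.
by have := ts v vt; rewrite inE => /num; rewrite vt mul1r mv eqxx.
Qed.

Lemma push_id x : realiz (deletion K tau) x -> push x = x.
Proof.
move=> Lx; have [x0 _] := Lx; rewrite inE => /andP[_ /subsetPn[v vt]].
rewrite inE negbK => /eqP xv.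
have m0 : min_on x = 0.
  apply/le_anti; rewrite -{1}xv min_on_le //=.
  by have [u _ ->] := min_on_attained Lx.
by apply/funext => u; rewrite /push m0 !mulr0 !subr0 divr1.
Qed.

Lemma push_cvg (Z : Type) (F : set_system Z) (FF : Filter F) (u : Z -> X) x v :
  realiz K x -> x <> barycenter -> u @ F --> x -> push (u z) v @[z --> F] --> push x v.
Proof.
move=> Kx xb ux; have d0 := push_den_gt0 Kx xb.
have mc : min_on (u z) @[z --> F] --> min_on x.
  exact: (@cvg_comp _ _ _ u min_on F _ _ ux (@min_on_cont x)).
have cv : u z v @[z --> F] --> x v.
  exact: (@cvg_comp _ _ _ u (fun y : X => y v) F _ _ ux (@coord_cont v x)).
apply: cvgM.
  by apply: cvgB => //; apply: cvgM => //; exact: cvg_cst.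
apply: cvgV; first by rewrite gt_eqF.
by apply: cvgB; [exact: cvg_cst|apply: cvgM => //; exact: cvg_cst].
Qed.

Hypothesis homeo : homeomorphic (realiz K) (@sphere3 R).

(** A face of K - tau does not meet the barycenter of [tau]. Moving its points in
    the sphere away from the image of the barycenter along great arcs, and pushing
    the result back to |K - tau|, contracts |K - tau|. *)
Lemma deletion_contractible : exists H b,
  uniform_contraction (R := R) (deletion K tau) H b.
Proof.
have [f [g [fP gP fc gc]]] := homeo.
pose q := f barycenter.
have [qs gq] := fP _ barycenter_in.
have fq (x : X) : realiz (deletion K tau) x -> sphere3 (f x) /\ f x <> q.
  move=> Lx; have [fs gx] := fP _ (deletion_sub Lx); split=> // e.
  by apply: (deletion_barycenter Lx); rewrite -gx e.
have gK (y : 'rV[R]_4) : sphere3 y -> y <> q -> realiz K (g y) /\ g y <> barycenter.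
  by move=> ys yq; have [gy fg] := gP _ ys; split=> // e; apply: yq; rewrite -fg e.
pose H (a : R) (x : X) : X := push (g (slide q a (f x))).
have HL (a : R) (x : X) : 0 <= a <= 1 ->
    realiz (deletion K tau) x -> realiz (deletion K tau) (H a x).
  move=> a01 /fq[fs fxq]; have [ss sq] := slide_sphere fs qs fxq a01.
  by have [gK1 gK2] := gK _ ss sq; exact: push_in.
have qNs : sphere3 (- q).
  by rewrite /sphere3 /= -qs; apply: eq_bigr => i _; rewrite mxE sqrrN.
have qNq : - q <> q.
  move=> e; have : \sum_(i < 4) q 0 i ^+ 2 = 0.
    apply: big1 => i _; have : (- q) 0 i = q 0 i by rewrite e.
    rewrite mxE => h; suff -> : q 0 i = 0 by rewrite expr0n.
    lra.
  by rewrite qs => /eqP; rewrite oner_eq0.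
have oi : 0 <= (1 : R) <= 1 by rewrite ler01 lexx.
exists H, (push (g (slide q 1 q))); split.
- have [ss sq] := slide_sphere qNs qs qNq oi; rewrite slide1 in ss sq.
  by have [gK1 gK2] := gK _ ss sq; exact: push_in.
- move=> x Lx; have [fs _] := fq _ Lx; rewrite /H slide0 //.
  by have [_ ->] := fP _ (deletion_sub Lx); exact: push_id.
- by move=> x Lx; rewrite /H slide1.
- exact: HL.
pose D : set (R * X) := `[0, 1] `*` realiz (deletion K tau).
have cD : compact D.
  apply: compact_setX; first exact: segment_compact.
  exact: realization_compact deletion_complex.
pose rho (i : option T) (z : R * X) : R := if i is Some v then z.2 v else z.1.
pose G (z : R * X) (v : T) : R := H z.1 z.2 v.
have rhoc i : continuous (rho i).
  case: i => [v|] z; last exact: cvg_fst.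
  exact: (@cvg_comp _ _ _ snd (fun y : X => y v) (nbhs z) _ _ cvg_snd (@coord_cont v z.2)).
have sep z z' : D z -> D z' -> (forall i, rho i z = rho i z') -> z = z'.
  move=> _ _ h; case: z z' h => [a x] [a' x'] h; have /= -> := h None.
  by congr (_, _); apply/funext => v; exact: (h (Some v)).
have Gc z v : D z -> G z' v @[z' --> within D (nbhs z)] --> G z v.
  move=> [z1 Lz]; rewrite /= in_itv /= in z1.
  have [fs fzq] := fq _ Lz; have [ss sq] := slide_sphere fs qs fzq z1.
  have [gK1 gK2] := gK _ ss sq.
  apply: push_cvg => //.
  pose F := within D (nbhs z).
  have c1 : (fun w : R * X => w.1) @ F --> z.1 by apply: cvg_within_filter; exact: cvg_fst.
  have c2 : (fun w : R * X => w.2) @ F --> z.2 by apply: cvg_within_filter; exact: cvg_snd.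
  have c3 : (fun w : R * X => f w.2) @ F --> f z.2.
    have /subspace_continuousP/(_ _ (deletion_sub Lz)) fz := fc.
    apply: within_comp c2 _ fz; apply: filterS (withinT _ _) => w [_].
    exact: deletion_sub.
  have c4 : (fun w : R * X => slide q w.1 (f w.2)) @ F --> slide q z.1 (f z.2).
    by apply: slide_cvg => //; exact: chord_neq0.
  have /subspace_continuousP/(_ _ ss) gz := gc.
  apply: within_comp c4 _ gz; apply: filterS (withinT _ _) => w [w1 Lw].
  rewrite /= in_itv /= in w1; have [fw fwq] := fq _ Lw.
  by have [] := slide_sphere fw qs fwq w1.
move=> d d0; have [e e0 He] := uniform_on_compact cD rhoc sep Gc d0.
exists e => // a a' x x' a01 a'01 Lx Lx' aa xx v.
apply: (He (a, x) (a', x')); rewrite /D /= ?in_itv //.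
by case=> [u|] /=; [exact: xx|].
Qed.
End Realization.

End PuncturedSphere.

(** * Counting faces *)

Lemma cauchy_count (I : finType) (g : I -> nat) :
  ((\sum_i g i) ^ 2 <= #|I| * \sum_i g i ^ 2)%N.
Proof.
rewrite -(leq_pmul2l (isT : 0 < 2)%N) expnS expn1 big_distrlr big_distrr /=.
have -> : (2 * (#|I| * \sum_i g i ^ 2) = \sum_i \sum_j (g i ^ 2 + g j ^ 2))%N.
  under [RHS]eq_bigr => i _ do rewrite big_split sum_nat_const /=.
  by rewrite big_split /= sum_nat_const -big_distrr /= mul2n addnn.
apply: leq_sum => i _; rewrite big_distrr; apply: leq_sum => j _; exact: nat_Cauchy.
Qed.

Section Counting.
Variables (T : finType) (K : {set {set T}}).
Implicit Types (s tau : {set T}) (A : {set {set T}}).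

Definition faces k := [set s in K | #|s| == k].

Definition euler A : int := \sum_(s in A) (-1) ^+ #|s|.

Lemma euler_balanced A :
  #|[set s in A | ~~ odd #|s| ]| = #|[set s in A | odd #|s| ]| -> euler A = 0.
Proof.
move=> h; rewrite /euler (bigID (fun s => odd #|s|)) /=.
rewrite (eq_bigr (fun _ => -1)) => [|s /andP[_ so]]; last by rewrite -signr_odd so.
rewrite [X in _ + X](eq_bigr (fun _ => 1)) => [|s /andP[_ so]]; last first.
  by rewrite -signr_odd (negbTE so).
have S (P : pred {set T}) (c : int) :
    \sum_(s in A | P s) c = c *+ #|[set s in A | P s]|.
  by rewrite -sumr_const; apply: eq_bigl => s; rewrite inE.
by rewrite !S h -mulrnDl addNr mul0rn.
Qed.

Lemma card_faces1 : #|faces 1| = #|vertices K|.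
Proof.
rewrite -(card_imset (mem (vertices K)) (@set1_inj T)); apply: eq_card => s.
rewrite inE; apply/andP/imsetP => [[sK /cards1P[v sv]]|[v vK ->]].
  by exists v; rewrite // inE -sv.
by rewrite cards1 eqxx; move: vK; rewrite inE => ->.
Qed.

Hypothesis cK : simplicial_complex K.
Hypothesis facet4 : forall s, facet K s -> #|s| = 4%N.
Hypothesis deletion0 : forall tau, tau \in K -> tau != set0 ->
  euler (deletion K tau) = 0.

Let K0 : set0 \in K := proj1 cK.
Let Ksub : forall s t : {set T}, s \in K -> t \subset s -> t \in K := proj2 cK.

Lemma in_facet s : s \in K -> exists2 t, facet K t & s \subset t.
Proof.
move=> sK; have [t tm st] := @maxset_exists _ [pred t in K] s sK.
by exists t.
Qed.

Lemma card_le4 s : s \in K -> (#|s| <= 4)%N.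
Proof. by case/in_facet => t /facet4 t4 /subset_leq_card; rewrite t4. Qed.

(** The faces not containing [tau] contribute 0. *)
Lemma euler_star tau : tau \in K -> tau != set0 ->
  euler K = \sum_(s in K | tau \subset s) (-1) ^+ #|s|.
Proof.
move=> tK t0; rewrite /euler (bigID (fun s => tau \subset s)) /=.
rewrite -[RHS]addr0; congr (_ + _); rewrite -[RHS](deletion0 tK t0).
by apply: eq_bigl => s; rewrite inE.
Qed.

(** A tetrahedron is the only face containing it. *)
Lemma euler_one : euler K = 1.
Proof.
have [t tf _] := in_facet K0; have tK : t \in K by case/maxsetP: tf.
have t4 := facet4 tf; rewrite (@euler_star t) //; last by rewrite -cards_eq0 t4.
rewrite (big_pred1 t) ?t4 // => s; apply/andP/eqP => [[sK ts]|->]; last by rewrite tK.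
by apply/esym/eqP; rewrite eqEcard ts t4 card_le4.
Qed.

(** The faces containing a triangle are the triangle, with sign -1, and the
    tetrahedra at it, with sign 1; the total is the Euler sum 1. *)
Lemma triangle_deg tau : tau \in faces 3 -> #|[set s in faces 4 | tau \subset s]| = 2%N.
Proof.
rewrite inE => /andP[tK /eqP t3].
have t0 : tau != set0 by rewrite -cards_eq0 t3.
have := euler_star tK t0; rewrite euler_one (bigD1 tau) ?tK ?subxx //= t3.
rewrite (eq_bigr (fun _ => 1)) => [|s /andP[/andP[sK ts] st]]; last first.
  have [h1 h2] := subset_leqif_cards ts; rewrite t3 [tau == s]eq_sym (negbTE st) in h1 h2.
  by have -> : #|s| = 4%N by have := card_le4 sK; lia.
pose P s := (s \in K) && (tau \subset s) && (s != tau).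
rewrite (eq_bigl (fun s => s \in [set s | P s])) => [|s]; last by rewrite inE.
rewrite sumr_const => h.
rewrite (_ : [set s in faces 4 | _] = [set s | P s]).
  move: h; rewrite natz -signr_odd expr1; move: #|_| => k h; lia.
apply/setP => s; rewrite /P !inE -!andbA; case sK: (s \in K) => //=.
case ts: (tau \subset s); rewrite ?andbF ?andbT //=.
have [h1 h2] := subset_leqif_cards ts; rewrite t3 in h1 h2.
by rewrite [s == tau]eq_sym -h2; have := card_le4 sK; lia.
Qed.

Lemma card_triangles s : s \in faces 4 -> #|[set tau in faces 3 | tau \subset s]| = 4%N.
Proof.
rewrite inE => /andP[sK /eqP s4]; have -> : 4%N = binomial #|s| 3 by rewrite s4.
rewrite -cards_draws.
apply: eq_card => t; rewrite !inE -andbA.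
by case ts: (t \subset s); rewrite ?andbF //= andbT (Ksub sK ts).
Qed.

(** Incidences between tetrahedra and triangles. *)
Lemma double_count : (4 * #|faces 4| = 2 * #|faces 3|)%N.
Proof.
rewrite ![(_ * #|_|)%N]mulnC -!sum_nat_const.
under eq_bigr => s sf do rewrite -(card_triangles sf) -sum1_card.
under [RHS]eq_bigr => s sf do rewrite -(triangle_deg sf) -sum1_card.
rewrite (exchange_big_dep (mem (faces 3))) /= => [|s t _]; last by rewrite inE => /andP[].
by apply: eq_bigr => t tf; apply: eq_bigl => s; rewrite !(inE, tf) /=.
Qed.

Lemma euler_faces :
  euler K = 1 - #|faces 1|%:Z + #|faces 2|%:Z - #|faces 3|%:Z + #|faces 4|%:Z.
Proof.
have part k : \sum_(s in faces k) (-1 : int) ^+ #|s| = (-1) ^+ k * #|faces k|%:Z.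
  rewrite (eq_bigr (fun _ => (-1) ^+ k)) => [|s]; last by rewrite inE => /andP[_ /eqP->].
  by rewrite sumr_const -mulr_natr natz.
transitivity (\sum_(k < 5) \sum_(s in faces k) (-1 : int) ^+ #|s|).
  rewrite /euler (partition_big (fun s => inord #|s| : 'I_5) predT) //=.
  apply: eq_bigr => k _; apply: eq_bigl => s; rewrite inE.
  case sK: (s \in K) => //=; rewrite -val_eqE /= inordK // ltnS; exact: card_le4.
rewrite !big_ord_recl big_ord0 !part /=.
have -> : #|faces 0| = 1%N.
  apply/eqP/cards1P; exists set0; apply/setP => s; rewrite !inE cards_eq0.
  by case: eqP => [->|_]; rewrite ?K0 ?andbF.
by rewrite /bump /=; ring.
Qed.

(** The sum [euler] also counts the empty face, which cancels the Euler sum 1; and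
    there are half as many tetrahedra as triangles. *)
Lemma tetrahedra_edges : (#|faces 4| + #|faces 1| = #|faces 2|)%N.
Proof.
have := euler_faces; rewrite euler_one; have := double_count.
move: #|faces 1| #|faces 2| #|faces 3| #|faces 4| => a b c d; lia.
Qed.

Variables (C : finType) (col : T -> C).
Hypothesis col_edge : forall u v, u != v -> [set u; v] \in K -> col u != col v.

(** An edge at [u] is determined by its other vertex, of another colour. *)
Lemma edge_degree u : 
  (#|[set s in faces 2 | u \in s]| <= #|[set w in vertices K | col w != col u]|)%N.
Proof.
apply: leq_trans (leq_imset_card (fun w => [set u; w]) _).
apply/subset_leq_card/subsetP => s; rewrite !inE => /andP[/andP[sK /cards2P[x [y [xy sE]]]] us].
have [w [wu sw]] : exists w, w != u /\ s = [set u; w].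
  move: us; rewrite sE !inE => /orP[/eqP->|/eqP->]; first by exists y; rewrite eq_sym.
  by exists x; split=> //; rewrite setUC.
apply/imsetP; exists w => //; rewrite !inE; apply/andP; split.
  by apply: Ksub sK _; rewrite sub1set sw !inE eqxx orbT.
by rewrite eq_sym; apply: col_edge; rewrite 1?eq_sym // -sw.
Qed.

(** Ordered pairs of vertices of equal colour number at least [#|V| ^ 2 / #|C|], by
    the Cauchy-Schwarz inequality on the sizes of the colour classes; each edge
    accounts for two of the other pairs. *)
Lemma turan_edges : 
  (2 * #|C| * #|faces 2| <= (#|C| - 1) * #|vertices K| ^ 2)%N.
Proof.
pose V := vertices K.
have h1 : (2 * #|faces 2| <= \sum_(u in V) #|[set w in V | col w != col u]|)%N.
  have -> : (2 * #|faces 2| = \sum_(u in V) #|[set s in faces 2 | u \in s]|)%N.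
    rewrite mulnC -sum_nat_const.
    under [RHS]eq_bigr => u _ do rewrite -sum1_card.
    rewrite (exchange_big_dep (mem (faces 2))) /= => [|u s _]; last first.
      by rewrite inE => /andP[].
    apply: eq_bigr => s sf; move: (sf); rewrite inE => /andP[sK /eqP s2].
    transitivity (\sum_(u in s) 1)%N; first by rewrite sum1_card.
    apply: eq_bigl => u; rewrite [RHS]andbC !inE sK s2 eqxx /=.
    case us: (u \in s) => //=; apply/esym; apply: Ksub sK _.
    by rewrite sub1set.
  by apply: leq_sum => u _; exact: edge_degree.
have h2 : (\sum_(u in V) #|[set w in V | col w != col u]| +
    \sum_(u in V) #|[set w in V | col w == col u]| = #|V| ^ 2)%N.
  rewrite -big_split /= expnS expn1 -sum_nat_const; apply: eq_bigr => u _.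
  rewrite -(cardsID [set w | col w == col u] V) addnC; congr (_ + _)%N; apply: eq_card => w;
  by rewrite !inE // andbC.
pose n i := #|[set w in V | col w == i]|.
have h3 : (\sum_(u in V) #|[set w in V | col w == col u]| = \sum_i n i ^ 2)%N.
  rewrite (partition_big col predT) //=; apply: eq_bigr => i _.
  rewrite (eq_bigr (fun _ => n i)) => [|u /andP[_ /eqP->] //].
  rewrite sum_nat_const expnS expn1; congr (_ * _)%N.
  by apply: eq_card => u; rewrite [RHS]inE.
have h4 : (\sum_i n i = #|V|)%N.
  rewrite -[RHS]sum1_card (partition_big col predT) //=; apply: eq_bigr => i _.
  by rewrite /n -sum1_card; apply: eq_bigl => u; rewrite inE.
have := cauchy_count n; rewrite h4 -h3 -/V.
move: h1 h2; move: (\sum_(u in V) _)%N (\sum_(u in V) _)%N (#|V|) (#|faces 2|) (#|C|).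
move=> a b v f c; nia.
Qed.

End Counting.

(** * Determinants of 0/1 matrices of size 4 *)

Definition lift01 (x : 'F_2) : int := (x : nat)%:Z.

Lemma lift01K (x : 'F_2) : (lift01 x)%:~R = x.
Proof. by case: x => [[|[|]]] // i; apply/val_inj. Qed.

Lemma map_lift01K m n (M : 'M['F_2]_(m, n)) :
  map_mx intr (map_mx lift01 M) = M.
Proof. by apply/matrixP => i j; rewrite !mxE lift01K. Qed.

(** Laplace expansion along the first row, with entries given by a function of two
    natural numbers: it unfolds to an explicit polynomial for a given size. *)
Fixpoint laplace n (f : nat -> nat -> int) : int :=
  if n is n'.+1 then
    foldr (fun j acc =>
        (-1) ^+ j * f 0%N j * laplace n' (fun i k => f i.+1 (bump j k)) + acc)
      0 (iota 0 n)
  else 1.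

Lemma laplaceE n f : laplace n f = \det (\matrix_(i < n, j < n) f i j).
Proof.
elim: n f => [|n IH] f; first by rewrite det_mx00.
rewrite (expand_det_row _ ord0).
have sumE (F : nat -> int) (s : seq nat) :
    foldr (fun j acc => F j + acc) 0 s = \sum_(j <- s) F j.
  by elim: s => [|j s IHs] /=; rewrite ?big_nil // big_cons IHs.
rewrite [LHS]sumE -[iota _ _]/(index_iota 0 n.+1) big_mkord.
apply: eq_bigr => j _; rewrite -/laplace mxE /cofactor add0n IH.
rewrite mulrAC mulrC; congr (_ * (_ * \det _)).
by apply/matrixP => i k; rewrite !mxE.
Qed.

(** Bases of F_2^4 whose 0/1 lift is not a basis of Z^4. *)
Definition bad_lift (M : 'M['F_2]_4) :=
  (M \in unitmx) && (\det (map_mx lift01 M) \isn't a GRing.unit).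

Definition bits4 : Type := (bool * bool * bool * bool)%type.

Definition all_bits4 : seq bits4 :=
  let bits := [:: false; true] in
  [seq (xyz, t) | xyz <- [seq (xy, z) | xy <- [seq (x, y) | x <- bits, y <- bits],
                                        z <- bits], t <- bits].

(** The operations of [int] stripped of the ring structure, and the sharing of minors
    and cofactors below, keep the evaluation over the 2^16 matrices cheap. *)
Definition addi : int -> int -> int := intZmod.addz.
Definition muli : int -> int -> int := intRing.mulz.
Definition oppi : int -> int := intZmod.oppz.

Definition minor2 (a b c d : bool) : int := addi (muli a d) (oppi (muli b c)).

Definition det3 (x y z : int) (a b c : bool) : int :=
  addi (addi (muli a x) (muli b y)) (muli c z).

(** A unit of F_2 lifts to an odd determinant, so the lift fails to be invertible
    only for an odd determinant other than 1 and -1. *)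
Definition bad_value (d : int) := odd `|d|%N && (`|d|%N != 1%N).

Definition dot4 (k : int * int * int * int) (d : bits4) : int :=
  let '(x, y, z, t) := k in let '(d0, d1, d2, d3) := d in
  addi (addi (muli d0 x) (muli d1 y)) (addi (muli d2 z) (muli d3 t)).

Definition minors (a b : bits4) :=
  let '(a0, a1, a2, a3) := a in let '(b0, b1, b2, b3) := b in
  (minor2 a0 a1 b0 b1, minor2 a0 a2 b0 b2, minor2 a0 a3 b0 b3,
   minor2 a1 a2 b1 b2, minor2 a1 a3 b1 b3, minor2 a2 a3 b2 b3).

Definition cofactors (m : int * int * int * int * int * int) (c : bits4) :=
  let '(m01, m02, m03, m12, m13, m23) := m in let '(c0, c1, c2, c3) := c in
  (oppi (det3 m23 (oppi m13) m12 c1 c2 c3), det3 m23 (oppi m03) m02 c0 c2 c3,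
   oppi (det3 m13 (oppi m03) m01 c0 c1 c3), det3 m12 (oppi m02) m01 c0 c1 c2).

Definition quad_det (a b c d : bits4) := dot4 (cofactors (minors a b) c) d.

Definition bad_quads : seq (bits4 * bits4 * bits4 * bits4) :=
  flatten [seq
    let m := minors ab.1 ab.2 in
    flatten [seq
      let k := cofactors m c in
      [seq (ab, c, d) | d <- all_bits4 & bad_value (dot4 k d)]
    | c <- all_bits4]
  | ab <- [seq (a, b) | a <- all_bits4, b <- all_bits4]].

Lemma size_bad_quads : size bad_quads = 120%N.
Proof. by vm_compute. Qed.

Definition bits_row (e : nat -> bool) : bits4 := (e 0%N, e 1%N, e 2%N, e 3%N).

Lemma quad_detE (e : nat -> nat -> bool) :
  quad_det (bits_row (e 0%N)) (bits_row (e 1%N)) (bits_row (e 2%N)) (bits_row (e 3%N)) =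
  \det (\matrix_(i < 4, j < 4) (e i j : nat)%:Z).
Proof.
pose f i j := (e i j : nat)%:Z; rewrite -(laplaceE 4 f) /quad_det /bits_row.
rewrite /minors /cofactors /minor2 /det3 /dot4.
rewrite (_ : addi = +%R) // (_ : muli = *%R) // (_ : oppi = -%R) //.
rewrite -!/(f _ _) /= /bump /= !(add1n, add0n).
ring.
Qed.

Lemma mem_all_bits4 a : a \in all_bits4.
Proof. by case: a => [[[[] []] []] []]. Qed.

Lemma mem_bad_quads a b c d : bad_value (quad_det a b c d) ->
  (a, b, c, d) \in bad_quads.
Proof.
move=> h; apply/flatten_mapP; exists (a, b).
  by apply: allpairs_f; exact: mem_all_bits4.
apply/flatten_mapP; exists c; first exact: mem_all_bits4.
by apply: map_f; rewrite mem_filter mem_all_bits4 andbT.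
Qed.

Definition quad_mx (q : bits4 * bits4 * bits4 * bits4) : 'M['F_2]_4 :=
  let '(a, b, c, d) := q in
  \matrix_(i < 4, j < 4)
    let '(x, y, z, t) := nth a [:: a; b; c; d] i in
    (nth false [:: x; y; z; t] j)%:R.

Lemma bad_liftP M : bad_lift M -> M \in map quad_mx bad_quads.
Proof.
move=> /andP[Mu Md].
pose e (i j : nat) := M (inord i) (inord j) == 1.
pose q := (bits_row (e 0%N), bits_row (e 1%N), bits_row (e 2%N), bits_row (e 3%N)).
have F2b (x : 'F_2) : lift01 x = (x == 1 : nat)%:Z.
  by case: x => [[|[|]]].
have liftE : map_mx lift01 M = \matrix_(i < 4, j < 4) (e i j : nat)%:Z.
  by apply/matrixP => i j; rewrite !mxE F2b /e !inord_val.
have -> : M = quad_mx q.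
  have F2b' (x : 'F_2) : x = (x == 1)%:R by case: x => [[|[|]]] // i; exact/val_inj.
  apply/matrixP => i j; rewrite mxE [LHS]F2b'.
  have -> : (M i j == 1) = e i j by rewrite /e !inord_val.
  by move: i j => [[|[|[|[|]]]] //= ?] [[|[|[|[|]]]] //= ?].
apply: map_f; apply: mem_bad_quads; rewrite quad_detE -liftE.
move: Mu Md; rewrite -{1}(map_lift01K M) unitmxE det_map_mx unitfE.
move: (\det _) => d; rewrite /bad_value.
have F2odd n : (n%:R : 'F_2) != 0 -> odd n.
  have ch : 2 \in [pchar 'F_2] by exact: pchar_Fp.
  by rewrite -(dvdn_pcharf ch) dvdn2 negbK.
case: d => n; rewrite ?NegzE ?rmorphN ?oppr_eq0 ?unitrN => /F2odd dodd du.
  by rewrite absz_nat dodd; apply: contraNneq du => ->; exact: unitr1.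
by rewrite abszN absz_nat dodd; apply: contraNneq du => ->; exact: unitr1.
Qed.

Lemma card_bad_lift : (#|[set M | bad_lift M]| <= 120)%N.
Proof.
rewrite -size_bad_quads -(size_map quad_mx).
apply: leq_trans (card_size _); apply/subset_leq_card/subsetP => M.
by rewrite inE => /bad_liftP.
Qed.

(** The order is 20160. Each basis is bad for 120 of the changes of coordinates,
    whence the factor 168: the number of tetrahedra that a change of coordinates
    can no longer be sure to avoid. *)
Lemma card_GL4 : #|'GL_4['F_2]%g| = (168 * 120)%N.
Proof.
by rewrite card_GL // card_Fp // unlock.
Qed.

(** * Integral lifts and bases *)

Section Lifting.

Lemma F2_neq0 (x : 'F_2) : x != 0 -> x = 1.
Proof. by case: x => [[|[|]]] // i _; exact/val_inj. Qed.

Lemma det_unitri_lift n (M : 'M['F_2]_n) : is_trig_mx M -> \det M != 0 ->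
  \det (map_mx lift01 M) = 1.
Proof.
move=> Mt; rewrite (det_trig Mt) det_trig => [h|].
  rewrite big1 // => i _; rewrite mxE (F2_neq0 (_ : M i i != 0)) //.
  by apply: contraNneq h => Mi; rewrite (bigD1 i) //= Mi mul0r.
by move/is_trig_mxP: Mt => Mt; apply/is_trig_mxP => i j ij; rewrite mxE Mt.
Qed.

(** In a factorization A = P^-1 L U, with P a permutation and L, U triangular, the
    diagonal entries of L and U are units of F_2, that is 1; so the 0/1 lifts of
    the three factors have determinant 1 or -1. *)
Lemma unimodular_lift n (A : 'M['F_2]_n.+1) : A \in unitmx ->
  exists2 G : 'M[int]_n.+1, G \in unitmx & map_mx intr G = A.
Proof.
move=> Au; have := cormen_lup_correct A; have := cormen_lup_perm A.
have := cormen_lup_detL A; have := @cormen_lup_lower _ n A.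
have := @cormen_lup_upper _ n A.
case: (cormen_lup A) => -[P L] U /= Uup Llow Ldet /is_perm_mxP[s Ps] PLU.
pose P' : 'M[int]_n.+1 := perm_mx s^-1%g.
have Udet : \det U != 0.
  have : \det (P *m A) != 0.
    by rewrite -unitfE -unitmxE unitmx_mul Au Ps unitmx_perm.
  by rewrite [P *m A]PLU -[L * U]/(L *m U) det_mulmx Ldet mul1r.
exists (P' *m map_mx lift01 L *m map_mx lift01 U).
  rewrite !unitmx_mul unitmx_perm /= !unitmxE; apply/andP; split.
    rewrite det_unitri_lift ?unitr1 // ?Ldet ?oner_neq0 //.
    apply/is_trig_mxP => i j ij; rewrite (Llow i j (ltnW ij)).
    by case: eqP ij => // ->; rewrite ltnn.
  rewrite -det_tr map_trmx det_unitri_lift ?unitr1 ?det_tr //.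
  by apply/is_trig_mxP => i j ij; rewrite mxE Uup.
rewrite !map_mxM !map_lift01K map_perm_mx -mulmxA.
rewrite -[L *m U]PLU Ps -[perm_mx s * A]/(perm_mx s *m A) mulmxA.
by rewrite -perm_mxM mulVg perm_mx1 mul1mx.
Qed.

Variable (T : finType).
Implicit Types s : {set T}.

Definition row_family (R : pzRingType) n (u : T -> 'rV[R]_n) (v0 : T) s : 'M[R]_n :=
  \matrix_(i < n) u (nth v0 (enum s) i).

Lemma family_sum (R : pzRingType) n (u : T -> 'rV[R]_n) v0 s (c : T -> R) :
  #|s| = n ->
  \sum_(i in s) c i *: u i = (\row_(k < n) c (nth v0 (enum s) k)) *m row_family u v0 s.
Proof.
move=> sn; rewrite mulmx_sum_row -big_enum (big_nth v0) /= -cardE sn big_mkord.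
by apply: eq_bigr => k _; rewrite mxE rowK.
Qed.

Lemma basis_unit (R : comUnitRingType) n (u : T -> 'rV[R]_n) v0 s :
  #|s| = n -> family_basis s u -> row_family u v0 s \in unitmx.
Proof.
move=> sn [_ sp].
have /choice[c cP] : forall j : 'I_n, exists c : T -> R,
  delta_mx 0 j = \sum_(i in s) c i *: u i by move=> j; exact: sp.
have : (\matrix_j (\row_k c j (nth v0 (enum s) k))) *m row_family u v0 s = 1%:M.
  apply/row_matrixP => j; rewrite row_mul rowK -family_sum // -cP.
  by rewrite row1.
by case/mulmx1_unit.
Qed.

Lemma unit_basis (R : comUnitRingType) n (u : T -> 'rV[R]_n) v0 s :
  #|s| = n -> row_family u v0 s \in unitmx -> family_basis s u.
Proof.
move=> sn Uu; split=> [c|x].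
  rewrite (family_sum _ v0) // => /(canRL (mulmxK Uu)); rewrite mul0mx => h i si.
  have ki : (index i (enum s) < n)%N by rewrite -sn cardE index_mem mem_enum.
  have /rowP/(_ (Ordinal ki)) := h; rewrite !mxE /= nth_index ?mem_enum //.
pose y := x *m invmx (row_family u v0 s).
have [n0|n0] := posnP n.
  exists (fun => 0); rewrite (family_sum _ v0) //; apply/rowP => -[k kn].
  by exfalso; rewrite n0 in kn.
exists (fun i => \sum_(k < n | k == index i (enum s) :> nat) y 0 k).
rewrite (family_sum _ v0) // -[LHS](mulmxKV Uu) -/y; congr (_ *m _).
apply/rowP => k; rewrite [RHS]mxE (big_pred1 k) // => l.
by rewrite index_uniq ?enum_uniq // -cardE sn.
Qed.

Lemma basis_card (F : fieldType) n (u : T -> 'rV[F]_n) s :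
  family_basis s u -> #|s| = n.
Proof.
move=> [fr sp].
pose U : 'M[F]_(#|s|, n) := \matrix_k u (enum_val k).
have US c : \sum_(i in s) c i *: u i = (\row_k c (enum_val k)) *m U.
  rewrite mulmx_sum_row big_enum_val; apply: eq_bigr => k _.
  by rewrite mxE rowK.
have /eqP <- : row_free U.
  apply: inj_row_free => v vU.
  pose c i := \sum_(k < #|s| | enum_val k == i) v 0 k.
  have cv : (\row_k c (enum_val k)) = v.
    apply/rowP => k; rewrite mxE /c (big_pred1 k) // => l.
    by rewrite (inj_eq enum_val_inj).
  apply/rowP => k; rewrite -cv [RHS]mxE mxE; apply: fr (enum_valP k).
  by rewrite US cv.
apply/eqP; rewrite -[_ == _]/(row_full U) -sub1mx; apply/row_subP => j.
have [c ->] := sp (row j 1%:M); rewrite US; exact: submxMl.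
Qed.

End Lifting.

(** * The lift *)

Lemma sphere_deletion_euler (R : realType) (T : finType) (K : {set {set T}}) :
  simplicial_3sphere R K -> forall tau : {set T}, tau \in K ->
  tau != set0 -> euler (deletion K tau) = 0.
Proof.
move=> [cK hK] tau tK t0; apply: euler_balanced.
have cL := deletion_complex t0 cK.
have [H [b Hb]] := deletion_contractible t0 cK tK hK.
exact: exact_even_odd cL (contractible_exact cL Hb).
Qed.

Lemma adjacent_distinct (T : finType) (K : {set {set T}}) (lamR : T -> 'rV['F_2]_4) :
  mod2_characteristic_map K lamR ->
  forall u v, u != v -> [set u; v] \in K -> lamR u != lamR v.
Proof.
move=> hl u v uv /in_facet[s sf]; rewrite subUset !sub1set => /andP[us vs].
have [fr _] := hl s sf; apply/eqP => e.
pose c w : 'F_2 := ((w == u) || (w == v))%:R.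
have : c u = 0; last by rewrite /c eqxx => /eqP; rewrite oner_eq0.
apply: (fr c _ u us); rewrite (bigD1 u) // (bigD1 v) /=; last by rewrite vs eq_sym.
rewrite big1 => [|w /andP[/andP[_ /negbTE wu] /negbTE wv]]; last first.
  by rewrite /c wu wv scale0r.
rewrite /c !eqxx orbT !scale1r addr0 e; apply/rowP => j.
by rewrite !mxE addF2.
Qed.

(** For n vertices, f_3 = f_1 - n <= 15 n^2 / 32 - n, which increases with n from
    n = 2 on and is 167.5 for n = 20. *)
Lemma few_tetrahedra (R : realType) (T : finType) (K : {set {set T}})
    (lamR : T -> 'rV['F_2]_4) :
  simplicial_3sphere R K -> mod2_characteristic_map K lamR ->
  (#|vertices K| <= 20)%N -> (#|faces K 4| <= 167)%N.
Proof.
move=> hK hl hn; have [cK _] := hK.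
have f4 s : facet K s -> #|s| = 4%N by move=> /hl/basis_card.
have := tetrahedra_edges cK f4 (sphere_deletion_euler hK).
have := turan_edges cK (adjacent_distinct hl).
rewrite card_faces1 card_mx card_Fp //= => h1 h2.
move: h1 h2 hn; move: #|faces K 4| #|faces K 2| #|vertices K| => a b n.
nia.
Qed.

Theorem theorem3p1 (R : realType) (T : finType) (K : {set {set T}})
    (hK : simplicial_3sphere R K) (hcard : (#|vertices K| <= 20)%N) :
  toric_lifting_property K.
Proof.
move=> lamR hl; have [[K0 _] _] := hK.
have f4 s : facet K s -> #|s| = 4%N by move=> /hl/basis_card.
have [s0 s0f _] := in_facet K0.
have [v0 _] : exists v, v \in s0 by apply/card_gt0P; rewrite f4.
pose B s := row_family lamR v0 s.
have [g gP] : exists g : {'GL_4['F_2]},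
    forall s, facet K s -> ~~ bad_lift (B s *m GLval g).
  apply: contrapT => /forallNP h.
  (* a facet matrix is invertible, so each bad matrix comes from one g *)
  have le120 s : s \in faces K 4 ->
      (\sum_(g : {'GL_4['F_2]}) bad_lift (B s *m GLval g) <= 120)%N.
    move=> s4; have /andP[sK /eqP s4'] : (s \in K) && (#|s| == 4%N) by rewrite inE in s4.
    have [t tf st] := in_facet sK.
    have Bu : B s \in unitmx.
      apply: basis_unit => //; suff -> : s = t by exact: hl.
      by apply/eqP; rewrite eqEcard st s4' f4.
    pose act (g : {'GL_4['F_2]}) := B s *m GLval g.
    have act_inj : injective act.
      move=> g g' gg; apply/val_inj => /=.
      by rewrite -[LHS](mulKmx Bu) -/(act g) gg /act mulKmx.
    have -> : (\sum_(g : {'GL_4['F_2]}) bad_lift (B s *m GLval g) =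
        #|act @^-1: [set M | bad_lift M]|)%N.
      rewrite -sum1_card [RHS]big_mkcond; apply: eq_bigr => g _.
      by rewrite !inE /act; case: (bad_lift _).
    apply: leq_trans card_bad_lift; rewrite -(card_imset _ act_inj).
    by apply/subset_leq_card/subsetP => M /imsetP[g]; rewrite inE => gb ->.
  have : (\sum_(g : {'GL_4['F_2]}) 1 <= \sum_(s in faces K 4) 120)%N.
    apply: (@leq_trans (\sum_(g : {'GL_4['F_2]}) \sum_(s in faces K 4)
        bad_lift (B s *m GLval g))%N).
      apply: leq_sum => g _; have /existsNP[s /not_implyP[sf /negP]] := h g.
      rewrite negbK => sb; rewrite (bigD1 s) /= ?sb //.
      by rewrite inE f4 // andbT; case/maxsetP: sf.
    by rewrite exchange_big /=; apply: leq_sum => s; exact: le120.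
  have -> : (\sum_(g : {'GL_4['F_2]}) 1 = 168 * 120)%N.
    by rewrite -card_GL4 -sum1_card; apply: eq_bigl => g; rewrite inE.
  by rewrite sum_nat_const leq_pmul2r // leqNgt ltnS (few_tetrahedra hK hl hcard).
have gu : GLval g \in unitmx by exact: (valP g).
have ginv : invmx (GLval g) \in unitmx by rewrite unitmx_inv.
have [G Gu GE] := unimodular_lift ginv.
exists (fun v => map_mx lift01 (lamR v *m GLval g) *m G); split=> [s sf|v vK].
  apply: (@unit_basis _ _ _ _ v0); first exact: f4.
  have -> : row_family (fun v => map_mx lift01 (lamR v *m GLval g) *m G) v0 s =
      map_mx lift01 (B s *m GLval g) *m G.
    by apply/row_matrixP => i; rewrite rowK row_mul -map_row row_mul rowK.
  rewrite unitmx_mul Gu andbT unitmxE.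
  have := gP s sf; rewrite /bad_lift unitmx_mul basis_unit ?f4 //=; last exact: hl.
  by rewrite gu negbK.
by rewrite map_mxM map_lift01K GE mulmxK.
Qed.
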